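(* Consider a sequence $(\mathcal{T}_n)_{n=1}^\infty$ of random finite unlabeled rooted trees, where $\mathcal{T}_n$ has $M_n$ vertices, and let $F_n$ be the spectral distribution of the adjacency matrix of $\mathcal{T}_n$. Suppose that $(\mathcal{T}_n)_{n=1}^\infty$ converges in the probability fringe sense to a random sin-tree $\mathcal{T} = (\mathcal{T}^0, \mathcal{T}^1, \ldots)$ and write $R$ for the root of $\mathcal{T}^0$. Then $F_n(\{0\})$ converges in distribution as $n \to \infty$ to \[ \sum_{k=0}^{\infty} \Big( \mathbb{P}\{R \in J_k(\mathcal{T})\} - \mathbb{P}\{R \in H_k(\mathcal{T})\} \Big). \]
   Context: Probability fringe convergence. Let $\mathbb{T}$ be the countable set of all finite unlabeled rooted trees (isomorphism classes of finite rooted trees, where isomorphisms preserve the root), with the discrete topology. Let $\mathbb{T}_\ast = \mathbb{T} \sqcup \{\ast\}$, where $\ast$ is an adjoined point, with the discrete topology, and give $\mathbb{T}^\infty$ and $\mathbb{T}_\ast^\infty$ the product topologies. For $\mathbf{t} \in \mathbb{T}$ with root $\rho$ and a vertex $v$ at distance $h \ge 0$ from the root, let $(v = v_0, v_1, \ldots, v_h = \rho)$ be the path from $v$ to the root. Let $t_0$ be the subtree rooted at $v_0$ consisting of all vertices whose path to the root passes through $v_0$ and, for $1 \le k \le h$, let $t_k$ be the subtree rooted at $v_k$ consisting of all vertices whose path to the root passes through $v_k$ but not through $v_{k-1}$. Let $\Phi(\mathbf{t}, \cdot)$ be the probability measure on $\mathbb{T}_\ast^\infty$ that places mass $(\#\mathbf{t})^{-1}$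 at each of the sequences $(t_0, t_1, \ldots, t_h, \ast, \ast, \ldots)$ as $v$ ranges over the $\#\mathbf{t}$ vertices of $\mathbf{t}$ (masses are added in case of coincidences). A sequence $(\mathcal{T}_n)$ of random elements of $\mathbb{T}$ converges in the probability fringe sense to a $\mathbb{T}^\infty$-valued random variable $\mathcal{T}$ if the random probability measures $\Phi(\mathcal{T}_n, \cdot)$ converge in distribution, in the topology of weak convergence of probability measures on $\mathbb{T}_\ast^\infty$, to the (deterministic) distribution of $\mathcal{T}$. An element $(t_0, t_1, \ldots)$ of $\mathbb{T}^\infty$ is called a sin-tree; it is identified with the infinite, locally finite tree obtained by joining the roots of $t_0, t_1, t_2, \ldots$ successively by edges to form a semi-infinite path. The spectral distribution of an $m \times m$ Hermitian matrix with eigenvalues $\mu_1, \ldots, \mu_m$ is $\frac{1}{m}\sum_{i=1}^m \delta_{\mu_i}$. The sets $H_k$ and $J_k$. Let $\mathbf{f}$ be a forest that is either finite, or infinite and such that every vertex is at finite graph distance from a leaf, with vertex set $V(\mathbf{f})$. A leaf is a vertex of degree one. Define forests $\mathbf{f}_k$, $k \ge 0$, all with vertex set $V(\mathbf{f})$, with edge set $E_k(\mathbf{f})$, set of leaves $L_k(\mathbf{f})$ and set of isolated (degree zero) vertices $I_k(\mathbf{f})$, by $\mathbf{f}_0 = \mathbf{f}$ and, for $k \ge 1$, $E_k(\mathbf{f})$ is obtained from $E_{k-1}(\mathbf{f})$ by removing all edges $\{y,z\} \in E_{k-1}(\mathbf{f})$ such that there exists $x \in L_{k-1}(\mathbf{f})$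 with $\{x,y\} \in E_{k-1}(\mathbf{f})$ (here $x = z$ is allowed, and the roles of $y$ and $z$ may be interchanged). Put \[ G_k(\mathbf{f}) := \{u \in L_k(\mathbf{f}) : \exists v \in L_k(\mathbf{f}) \text{ with } \{u,v\} \in E_k(\mathbf{f})\}, \] \[ H_k(\mathbf{f}) := \{u \in V(\mathbf{f}) \setminus L_k(\mathbf{f}) : \exists v \in L_k(\mathbf{f}) \text{ with } \{u,v\} \in E_k(\mathbf{f})\}, \] \[ J_k(\mathbf{f}) := (I_{k+1}(\mathbf{f}) \setminus I_k(\mathbf{f})) \setminus (G_k(\mathbf{f}) \cup H_k(\mathbf{f})). \] In the claim these are applied to the infinite tree $\mathcal{T}$. *)

(* Defs.v *)
From HB Require Import structures.
From mathcomp Require Import all_boot all_order all_algebra.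
From mathcomp Require Import generic_quotient spectral zify.
From mathcomp Require Import complex.
From mathcomp Require Import all_classical all_reals all_analysis.
Import numFieldNormedType.Exports.
Import Order.TTheory GRing.Theory Num.Theory.

Set Implicit Arguments.
Unset Strict Implicit.
Unset Printing Implicit Defensive.

Local Open Scope classical_set_scope.

Section Trees.
Variable V : eqType.
Implicit Types (e : rel V) (x y : V) (p : seq V).

Definition simple_path e x y p :=
  [/\ path e x p, uniq (x :: p) & last x p = y].

Definition is_tree e :=
  [/\ symmetric e, irreflexive e & forall x y, exists! p, simple_path e x y p].

End Trees.

(* A finite graph on the vertices 0, ..., n given by its boolean adjacency
   matrix, together with a root. *)
Definition rooted_graph := {n : nat & ('M[bool]_n.+1 * 'I_n.+1)%type}.

Definition rg_vertex (g : rooted_graph) : finType := 'I_(tag g).+1.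
Definition rg_edge (g : rooted_graph) : rel (rg_vertex g) :=
  fun x y => (tagged g).1 x y.
Definition rg_root (g : rooted_graph) : rg_vertex g := (tagged g).2.

Definition rooted_tree := {g : rooted_graph | `[< is_tree (@rg_edge g) >]}.

Section RootedTree.
Variable t : rooted_tree.

(* One less than the number of vertices. *)
Definition rt_pred_size : nat := tag (sval t).
Definition rt_vertex : finType := 'I_rt_pred_size.+1.
Definition rt_edge : rel rt_vertex := @rg_edge (sval t).
Definition rt_root : rt_vertex := rg_root (sval t).

Lemma rt_is_tree : is_tree rt_edge.
Proof. by have /asboolP := valP t. Qed.

End RootedTree.

Definition rooted_iso (s t : rooted_tree) : bool :=
  `[< exists f : rt_vertex s -> rt_vertex t,
      [/\ bijective f, f (rt_root s) = rt_root t &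
          forall x y, rt_edge (f x) (f y) = rt_edge x y] >].

Lemma rooted_iso_refl : reflexive rooted_iso.
Proof. by move=> t; apply/asboolP; exists id; split=> //; exists id. Qed.

Lemma rooted_iso_sym : symmetric rooted_iso.
Proof.
suff imp s t : rooted_iso s t -> rooted_iso t s.
  by move=> s t; apply/idP/idP; exact: imp.
move=> /asboolP[f [[g fK gK] froot fE]]; apply/asboolP; exists g; split.
- by exists f.
- by rewrite -froot fK.
- by move=> x y; rewrite -fE !gK.
Qed.

Lemma rooted_iso_trans : transitive rooted_iso.
Proof.
move=> t s u /asboolP[f [fb froot fE]] /asboolP[g [gb groot gE]].
apply/asboolP; exists (g \o f); split.
- exact: bij_comp.
- by rewrite /= froot.
- by move=> x y /=; rewrite gE fE.
Qed.

Canonical rooted_iso_equiv :=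
  EquivRel rooted_iso rooted_iso_refl rooted_iso_sym rooted_iso_trans.

(* Finite unlabeled rooted trees: isomorphism classes of finite rooted trees. *)
Definition utree := {eq_quot rooted_iso}%qT.
HB.instance Definition _ := Choice.on utree.
HB.instance Definition _ := Quotient.on utree.

Section IsoClass.
Variables (V : finType) (e : rel V) (r : V).

Definition relabel : rooted_graph :=
  existT _ #|V|.-1 ((\matrix_(i, j) e (nth r (enum V) i) (nth r (enum V) j))%R,
                    inord (index r (enum V))).

Let label (x : V) : rg_vertex relabel := inord (index x (enum V)).

Let V_gt0 : 0 < #|V|. Proof. by apply/card_gt0P; exists r. Qed.

Let labelK : cancel label (fun i : rg_vertex relabel => nth r (enum V) i).
Proof.
move=> x; rewrite /label inordK ?nth_index ?mem_enum//.
by rewrite prednK// cardE index_mem mem_enum.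
Qed.

Let unlabelK : cancel (fun i : rg_vertex relabel => nth r (enum V) i) label.
Proof.
move=> i; rewrite /label index_uniq ?enum_uniq ?inord_val//.
by rewrite -cardE; have := ltn_ord i; rewrite [X in _ < X]prednK.
Qed.

Lemma relabel_is_tree : is_tree e -> is_tree (@rg_edge relabel).
Proof.
pose g (i : rg_vertex relabel) := nth r (enum V) i.
have gI : injective g by exact: can_inj unlabelK.
have gE i j : rg_edge i j = e (g i) (g j) by rewrite /rg_edge /= mxE.
move=> [es ei eu]; split.
- by move=> i j; rewrite !gE es.
- by move=> i; rewrite gE ei.
have sp i j p : simple_path (@rg_edge relabel) i j p <->
                simple_path e (g i) (g j) (map g p).
  rewrite /simple_path -map_cons map_inj_uniq// last_map path_map.
  rewrite (@eq_path _ (relpre g e) (@rg_edge relabel)); last first.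
    by move=> x y; rewrite gE.
  by split=> -[? ? h]; split=> //; [rewrite h|exact: gI].
move=> i j; have [p [pp pu]] := eu (g i) (g j).
exists (map label p); split.
  by apply/sp; rewrite -map_comp (eq_map labelK) map_id.
move=> q /sp /pu ->; rewrite -map_comp.
by rewrite (eq_map unlabelK) map_id.
Qed.

(* The isomorphism class of the finite tree (V, e) rooted at r. *)
Definition iso_class (et : is_tree e) : utree :=
  \pi_utree%qT (exist (fun g => `[< is_tree (@rg_edge g) >]) relabel
    (introT (asboolP _) (relabel_is_tree et))).

End IsoClass.

Section Spine.
Variable t : rooted_tree.
Implicit Types u v w : rt_vertex t.

Lemma path_to_root_ex v : exists p, simple_path (@rt_edge t) v (rt_root t) p.
Proof. by have [_ _ /(_ v (rt_root t))[p []]] := rt_is_tree t; exists p. Qed.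

(* The path (v_0 = v, v_1, ..., v_h = root). *)
Definition path_to_root v : seq (rt_vertex t) :=
  v :: sval (cid (path_to_root_ex v)).

Lemma path_to_root_uniq w : uniq (path_to_root w).
Proof. by rewrite /path_to_root; case: cid => p []. Qed.

Lemma path_to_root_cat w (p q : seq (rt_vertex t)) :
  path_to_root w = w :: p ++ q ->
  path_to_root (last w p) = last w p :: q.
Proof.
rewrite {1}/path_to_root; case: cid => r /= [rp ru rl] [rE].
rewrite /path_to_root; case: cid => q' /= hq'; congr cons.
have [_ _ /(_ (last w p) (rt_root t))[p0 [_ p0u]]] := rt_is_tree t.
rewrite -(p0u q') // -(p0u q) //.
move: rp ru rl; rewrite rE cat_path last_cat => /andP[_ pq] ru ql; split=> //.
move: ru; rewrite -cat_cons lastI cat_rcons cat_uniq.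
by case/and3P.
Qed.

Lemma path_to_root_drop v k : k < size (path_to_root v) ->
  path_to_root (nth v (path_to_root v) k) = drop k (path_to_root v).
Proof.
have [b bE] : exists b, path_to_root v = v :: b by eexists.
rewrite bE ltnS => kb.
have lastE : last v (take k b) = nth v (v :: b) k.
  by rewrite (last_nth v) size_takel//; case: k kb => //= k kb; rewrite nth_take.
have /path_to_root_cat : path_to_root v = v :: take k b ++ drop k b.
  by rewrite cat_take_drop.
by rewrite lastE => ->; rewrite -drop_nth.
Qed.

(* For i > 0: the vertices whose path to the root passes through v_i but not
   through v_(i-1); for i = 0: those whose path passes through v_0. *)
Definition spine_part v (i : 'I_(size (path_to_root v))) :
    {set rt_vertex t} :=
  [set w | (nth v (path_to_root v) i \in path_to_root w) &&
           ((0 < i) ==> (nth v (path_to_root v) i.-1 \notin path_to_root w))].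

Section Part.
Variables (v : rt_vertex t) (i : 'I_(size (path_to_root v))).
Let vi := nth v (path_to_root v) i.

Lemma spine_root : vi \in spine_part i.
Proof.
rewrite inE /vi mem_head /=; apply/implyP => i0.
rewrite path_to_root_drop//; apply/negP => /(nthP v)[k].
rewrite size_drop nth_drop => kl /eqP.
by rewrite nth_uniq ?path_to_root_uniq//; lia.
Qed.

Definition spine_vertex : finType := {w : rt_vertex t | w \in spine_part i}.

Definition spine_edge : rel spine_vertex := relpre val (@rt_edge t).

Let spine_connect (w : spine_vertex) : connect spine_edge w (Sub vi spine_root).
Proof.
have conn q : forall w : spine_vertex, path (@rt_edge t) (val w) q ->
    all (mem (spine_part i)) q -> last (val w) q = vi ->
    connect spine_edge w (Sub vi spine_root).
  elim: q => [|z q IH] {}w /=.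
    by move=> _ _ wvi; have -> : w = Sub vi spine_root by exact: val_inj.
  move=> /andP[wz zq] /andP[zS qS] qvi.
  by apply: (@connect_trans _ _ (Sub z zS)); [exact: connect1|exact: IH].
have /setIdP[viw no] := valP w.
have wE : path_to_root (val w) = val w :: behead (path_to_root (val w)) by [].
have wp : path (@rt_edge t) (val w) (behead (path_to_root (val w))).
  by rewrite /path_to_root; case: cid => ? [].
move: viw wp; rewrite wE; case/splitPl pE : _ / => [p1 p2 p1l].
rewrite cat_path => /andP[p1p _]; apply: (conn p1) => //.
apply/allP => z zp1; have : z \in val w :: p1 by rewrite inE zp1 orbT.
case/splitPl p1E : _ / => [a b az].
have := @path_to_root_cat (val w) a (b ++ p2).
rewrite catA -p1E -pE -wE => /(_ erefl); rewrite az => zE.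
suff: z \in spine_part i by [].
rewrite finset.in_set zE; apply/andP; split.
  rewrite -p1l p1E last_cat az -cat_cons mem_cat.
  by rewrite mem_last.
apply/implyP => i0; move/implyP: no => /(_ i0); apply: contra => xz.
rewrite wE pE p1E -catA -cat_cons lastI az cat_rcons mem_cat.
by rewrite xz orbT.
Qed.

Lemma spine_is_tree : is_tree spine_edge.
Proof.
have [es ei eu] := rt_is_tree t.
have es' : symmetric spine_edge by move=> x y; exact: es.
split=> [//|x|x y]; first exact: ei.
have /connectP[p pp ->] : connect spine_edge x y.
  apply: (connect_trans (spine_connect x)).
  by rewrite (sym_connect_sym es') spine_connect.
case/shortenP: pp => q qp qu _; exists q; split=> // r [rp ru rl].
have sp (s : seq spine_vertex) : path spine_edge x s -> uniq (x :: s) ->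
    simple_path (@rt_edge t) (val x) (val (last x s)) (map val s).
  move=> sp su; split; rewrite ?last_map//.
  - by rewrite path_map.
  - by rewrite -map_cons map_inj_uniq//; exact: val_inj.
have [p0 [_ p0u]] := eu (val x) (val (last x q)).
apply: (inj_map val_inj).
by rewrite -(p0u _ (sp q qp qu)) -(p0u (map val r)) // -rl; exact: sp.
Qed.

(* The tree t_i of the decomposition, rooted at v_i. *)
Definition spine_tree : utree :=
  iso_class (Sub vi spine_root : spine_vertex) spine_is_tree.

End Part.

(* The sequence (t_0, ..., t_h, *, *, ...), with [None] in the role of [*]. *)
Definition fringe v : nat -> option utree :=
  fun k => omap (@spine_tree v) (insub k).

End Spine.

Local Open Scope ring_scope.

Notation borel S := (g_sigma_algebraType (@open S)).

Section WeakConvergence.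
Variables (R : realType) (S : ptopologicalType).

Definition bounded_continuous := {f : S -> R | continuous f /\ bounded_fun f}.
HB.instance Definition _ := gen_eqMixin bounded_continuous.
HB.instance Definition _ := gen_choiceMixin bounded_continuous.

(* Continuity of [mu |-> int f dmu] for every bounded continuous [f] generates
   the topology of weak convergence. *)
Definition integral_functionals (mu : probability (borel S) R) :
    {ptws bounded_continuous -> R} :=
  fun f => (\int[mu]_(x in [set: borel S]) (sval f x))%R.

Definition law_space := initial_topology integral_functionals.

HB.instance Definition _ := Topological.on law_space.
HB.instance Definition _ := Pointed.copy law_space (probability (borel S) R).

(* Random elements converge in distribution when their laws, which all live in
   [law_space] whatever the underlying probability spaces, converge there. *)
Definition law (d : measure_display) (Om : measurableType d)
    (P : probability Om R) (X : {mfun Om >-> borel S}) : law_space :=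
  distribution P X.

Definition point_law (x : S) : law_space := @dirac _ (borel S) x R.

End WeakConvergence.

Section Empirical.
Variables (R : realType) (d : measure_display) (X : measurableType d).
Variables (n : nat) (x : 'I_n.+1 -> X).

Definition empirical : set X -> \bar R :=
  mscale ((n.+1%:R^-1 : R)%:nng) (msum (fun i => dirac (x (inord i))) n.+1).

HB.instance Definition _ := Measure.on empirical.

Let empirical_setT : empirical setT = 1%E.
Proof.
rewrite /empirical /mscale /msum /=.
transitivity ((n.+1%:R^-1 : R)%:E * (\sum_(k < n.+1) 1%E))%E.
  by congr (_ * _)%E; apply: eq_bigr => i _; exact: diracT.
rewrite sumEFin big_const_ord iter_addr addr0.
by rewrite -EFinM mulVf.
Qed.

HB.instance Definition _ :=
  Measure_isProbability.Build _ _ _ empirical empirical_setT.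

End Empirical.

Definition single_vertex : rooted_graph :=
  existT _ 0%N (\matrix_(i, j) false, ord0).

Lemma single_vertex_is_tree : is_tree (@rg_edge single_vertex).
Proof.
have eF x y : @rg_edge single_vertex x y = false by rewrite /rg_edge /= mxE.
split=> [x y|x|x y]; rewrite ?eF//; exists [::]; split=> [|p [pp _ _]].
  by split=> //=; rewrite (ord1 x) (ord1 y).
by case: p pp => //= z p; rewrite eF.
Qed.

HB.instance Definition _ := isPointed.Build utree
  (\pi_utree%qT (exist (fun g => `[< is_tree (@rg_edge g) >]) single_vertex
    (introT (asboolP _) single_vertex_is_tree))).
HB.instance Definition _ := hasNbhs.Build utree principal_filter.
HB.instance Definition _ := Discrete_ofNbhs.Build utree erefl.
HB.instance Definition _ := DiscreteUniform_ofNbhs.Build utree.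

(* [None] is the adjoined point. *)
Definition utree_star := option utree.
HB.instance Definition _ := Choice.on utree_star.
HB.instance Definition _ := isPointed.Build utree_star None.
HB.instance Definition _ := hasNbhs.Build utree_star principal_filter.
HB.instance Definition _ := Discrete_ofNbhs.Build utree_star erefl.
HB.instance Definition _ := DiscreteUniform_ofNbhs.Build utree_star.

Definition sin_tree := {ptws nat -> utree}.
HB.instance Definition _ := Topological.on sin_tree.
HB.instance Definition _ := isPointed.Build sin_tree (fun=> point).

Definition star_sequence := {ptws nat -> utree_star}.
HB.instance Definition _ := Topological.on star_sequence.
HB.instance Definition _ := isPointed.Build star_sequence (fun=> None).

Lemma utree_measurable_fun (S : ptopologicalType) (f : utree -> S) :
  measurable_fun setT (f : borel utree -> borel S).
Proof.
by move=> _ Y mY; rewrite setTI; apply: sub_sigma_algebra; exact: discrete_open.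
Qed.

Lemma continuous_borel (S S' : ptopologicalType) (f : S -> S') :
  continuous f -> measurable_fun setT (f : borel S -> borel S').
Proof.
move=> /continuousP fc.
apply: (@measurability _ _ (borel S) (borel S') setT f (@open S') erefl).
by move=> _ [U oU <-]; rewrite setTI; apply: sub_sigma_algebra; exact: fc.
Qed.

Definition star_embedding (s : borel sin_tree) : borel star_sequence :=
  fun k => Some (s k).

Lemma star_embedding_continuous :
  continuous (star_embedding : sin_tree -> star_sequence).
Proof.
move=> s; apply/pointwise_cvgP => k.
apply: (@continuous_comp _ _ _ (fun s : sin_tree => s k)
  (Some : utree -> utree_star)).
  exact: (@proj_continuous _ (fun=> utree)).
move=> A /principal_filterP Ax; exact/principal_filterP.
Qed.

HB.instance Definition _ := isMeasurableFun.Build _ _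
  (borel sin_tree) (borel star_sequence) star_embedding
  (continuous_borel star_embedding_continuous).

Section Fringe.
Variable R : realType.

(* Isomorphic representatives give the same measure: coinciding sequences have
   their masses added. *)
Definition fringe_distribution (t : borel utree) :
    borel (law_space R star_sequence) :=
  @empirical R _ (borel star_sequence) _ (@fringe (repr t)) :
    probability (borel star_sequence) R.

HB.instance Definition _ := isMeasurableFun.Build _ _
  (borel utree) (borel (law_space R star_sequence)) fringe_distribution
  (@utree_measurable_fun _ fringe_distribution).

Definition probability_fringe_cvg
    (d : nat -> measure_display) (Om : forall n, measurableType (d n))
    (P : forall n, probability (Om n) R)
    (T : forall n, {mfun Om n >-> borel utree})
    (d' : measure_display) (Om' : measurableType d') (P' : probability Om' R)
    (T' : {mfun Om' >-> borel sin_tree}) : Prop :=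
  law (P n) (fringe_distribution \o T n) @[n --> \oo] -->
    point_law R (law P' (star_embedding \o T')).

End Fringe.

Section Spectrum.
Variable R : realType.
Local Notation C := R[i].

(* The eigenvalues of a Hermitian matrix, listed with multiplicity by
   [spectral_diag], are real. *)
Definition spectral_distribution (n : nat) (A : 'M[C]_n.+1) :
    set (borel R) -> \bar R :=
  @empirical R _ (borel R) n (fun i => complex.Re (spectral_diag A ord0 i)).

HB.instance Definition _ n (A : 'M[C]_n.+1) :=
  Probability.on (spectral_distribution A).

Definition adjacency_matrix (t : rooted_tree) : 'M[C]_((rt_pred_size t).+1) :=
  \matrix_(i, j) (@rt_edge t i j)%:R.

Lemma adjacency_matrix_hermitian (t : rooted_tree) :
  adjacency_matrix t \is hermsymmx.
Proof.
apply/is_hermitianmxP/matrixP => i j.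
have [es _ _] := rt_is_tree t.
by rewrite !mxE expr0 mul1r conjC_nat es.
Qed.

Definition mass_at_zero (t : borel utree) : borel R :=
  fine (spectral_distribution (adjacency_matrix (repr t)) [set 0]).

HB.instance Definition _ := isMeasurableFun.Build _ _
  (borel utree) (borel R) mass_at_zero
  (@utree_measurable_fun _ mass_at_zero).

End Spectrum.

Section LeafRemoval.
Variables (V : Type) (E : V -> V -> Prop).
Implicit Types (e : V -> V -> Prop) (k : nat).

Definition leaves e : set V := [set x | exists! y, e x y].
Definition isolated e : set V := [set x | forall y, ~ e x y].

Fixpoint peel k : V -> V -> Prop :=
  if k is k'.+1 then fun y z =>
    peel k' y z /\
    ~ exists2 x, leaves (peel k') x & peel k' x y \/ peel k' x z
  else E.

Definition G_set k : set V := [set u | leaves (peel k) u /\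
  exists2 v, leaves (peel k) v & peel k u v].

Definition H_set k : set V := [set u | ~ leaves (peel k) u /\
  exists2 v, leaves (peel k) v & peel k u v].

Definition J_set k : set V :=
  (isolated (peel k.+1) `\` isolated (peel k)) `\` (G_set k `|` H_set k).

End LeafRemoval.

Section SinTree.
Variable s : nat -> utree.

Definition sin_vertex := {k : nat & rt_vertex (repr (s k))}.

Definition sin_root_at (k : nat) : sin_vertex :=
  Tagged (fun k => rt_vertex (repr (s k))) (rt_root (repr (s k))).

(* The edges of the trees s_k, and edges joining the roots of s_k and
   s_(k + 1). *)
Definition sin_edge (u v : sin_vertex) : Prop :=
  [\/ tag u = tag v /\ rt_edge (tagged u) (tagged_as u v),
      exists k, u = sin_root_at k /\ v = sin_root_at k.+1 |
      exists k, u = sin_root_at k.+1 /\ v = sin_root_at k].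

Definition sin_root : sin_vertex := sin_root_at 0.

End SinTree.

(* Main.v *)
Require Import Defs.
From HB Require Import structures.
From mathcomp Require Import all_boot all_order all_algebra.
From mathcomp Require Import generic_quotient spectral zify ring lra complex.
From mathcomp Require Import all_classical all_reals all_analysis.
From mathcomp Require Import measurable_realfun.
Import numFieldNormedType.Exports.
Import Order.TTheory GRing.Theory Num.Theory.
(* Restores [isolated] as a graph notion, shadowed by the topological one. *)
Import Defs.

(* Let I_k be the set of isolated vertices after k peelings of a finite graph.
   A vertex adjacent to a leaf contributes a unit row to the adjacency matrix;
   clearing the corresponding columns, and then the rows, shows that the k-th
   peeling lowers the rank by |G_k| + 2 |H_k|, while it creates
   |G_k| + |H_k| + |J_k| isolated vertices.  Hence the nullity is
     |I_0| + \sum_(k < K) (|J_k| - |H_k|)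
   up to an error between 0 and the number of vertices outside I_K.
   Peeling being local, whether a vertex belongs to I_k, J_k or H_k depends on
   finitely many trees of its fringe decomposition, so that the proportion of
   such vertices is the mass that the fringe distribution gives to a clopen set
   of sequences; these masses converge by hypothesis.  The error is controlled
   by P(R not in I_K), which tends to 0: a sin-tree has a single end, so every
   vertex becomes isolated at a finite stage.  The same bound makes the series
   converge, since |J_k| + |H_k| is dominated by the growth of I_k. *)

Set Implicit Arguments.
Unset Strict Implicit.
Unset Printing Implicit Defensive.

Local Open Scope classical_set_scope.
Local Open Scope ring_scope.

(** * Peeling *)

Section PeelTheory.
Variables (V : Type) (E : V -> V -> Prop).
Hypothesis E_sym : forall x y, E x y -> E y x.
Local Open Scope nat_scope.

Lemma peel_sym k x y : peel E k x y -> peel E k y x.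
Proof.
elim: k x y => [|k IH] x y /=; first exact: E_sym.
move=> [exy nx]; split; first exact: IH.
by move=> [z lz zxy]; apply: nx; exists z => //; case: zxy; [right|left].
Qed.

Lemma peel_le k m x y : k <= m -> peel E m x y -> peel E k x y.
Proof.
move=> /subnK <-; elim: (m - k) => [//|i IH]; rewrite addSn /=.
by move=> [/IH].
Qed.

Lemma isolated_le k m : k <= m -> isolated (peel E k) `<=` isolated (peel E m).
Proof. by move=> km x xk y /(peel_le km); exact: xk. Qed.

Lemma leaf_nbr_isolated k x y :
  leaves (peel E k) x -> peel E k x y -> isolated (peel E k.+1) y.
Proof. by move=> lx xy z [_]; apply; exists x => //; left. Qed.

Lemma leaf_isolated k x : leaves (peel E k) x -> isolated (peel E k.+1) x.
Proof.
move=> lx z [xz]; apply; have [y [xy yu]] := lx; exists x => //; right.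
exact: xz.
Qed.

Lemma G_set_isolated k : G_set E k `<=` isolated (peel E k.+1).
Proof. by move=> x [lx _]; exact: leaf_isolated. Qed.

Lemma H_set_isolated k : H_set E k `<=` isolated (peel E k.+1).
Proof.
by move=> x [_ [v lv /peel_sym xv]]; exact: leaf_nbr_isolated xv.
Qed.

Lemma G_set_not_isolated k x : G_set E k x -> ~ isolated (peel E k) x.
Proof. by move=> [_ [v _ xv]] /(_ v). Qed.

Lemma H_set_not_isolated k x : H_set E k x -> ~ isolated (peel E k) x.
Proof. by move=> [_ [v _ xv]] /(_ v). Qed.

(** [J_set] is by definition what becomes isolated outside [G_set] and [H_set]; conversely a leaf,
    and any neighbour of a leaf, loses all its edges in one peeling. *)
Lemma isolated_peelS k : isolated (peel E k.+1) =
  isolated (peel E k) `|` (G_set E k `|` (H_set E k `|` J_set E k)).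
Proof.
rewrite eqEsubset; split=> x.
  move=> xi; have [xk|xk] := pselect (isolated (peel E k) x); first by left.
  right; have [xG|xG] := pselect (G_set E k x); first by left.
  right; have [xH|xH] := pselect (H_set E k x); first by left.
  by right; split=> // -[].
move=> [|[|[|]]].
- exact: isolated_le.
- exact: G_set_isolated.
- exact: H_set_isolated.
- by move=> [[]].
Qed.

(* A function [h] decreasing along all edges but at most one at every vertex
   orients the forest towards an end; stage [h x] of the peeling has then
   disposed of everything below [x]. *)
Lemma peel_height (h : V -> nat) :
  (forall x y z, E x y -> E x z -> y <> z -> h y < h x \/ h z < h x) ->
  forall k x, h x <= k -> forall y, peel E k x y -> ~ h y < h x.
Proof.
move=> hE; elim=> [|k IH] x xk y /=; first by lia.
(* The lower neighbour [y] is a leaf of stage [k], so that its edge to [x] is removed: a second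
   neighbour [z] of [y] would have to lie below [y], since [x] lies above, and induction at [y]
   forbids this. *)
move=> [xy nx] yx; apply: nx; exists y; last by left; exact: peel_sym.
have yk : h y <= k by lia.
exists x; split; first exact: peel_sym.
move=> z yz; apply: contrapT => xz.
have Ex : E y x by apply: (@peel_le 0 k) => //; exact: peel_sym.
have Ez : E y z by exact: (@peel_le 0 k).
by have [|/(IH y yk z yz)//] := hE _ _ _ Ex Ez xz; lia.
Qed.

(** After [h x] peelings no downward edge is left at [x], hence at most one edge in all; [x] is then
    isolated or a leaf, and one more peeling settles the second case. *)
Lemma height_isolated (h : V -> nat) :
  (forall x y z, E x y -> E x z -> y <> z -> h y < h x \/ h z < h x) ->
  forall x, isolated (peel E (h x).+1) x.
Proof.
move=> hE x; have nc := peel_height hE (leqnn (h x)).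
move=> y xy; apply: (leaf_isolated _ xy); exists y.
have xy' : peel E (h x) x y by exact: (peel_le (leqnSn _)) xy.
split=> // z xz; apply: contrapT => yz.
have Ey : E x y by exact: (@peel_le 0 (h x)).
have Ez : E x z by exact: (@peel_le 0 (h x)).
by have [/(nc _ xy')|/(nc _ xz)] := hE _ _ _ Ey Ez yz.
Qed.

End PeelTheory.

(** * Locality of peeling *)

Section PeelLocal.
Variables (V W : Type) (E : V -> V -> Prop) (F : W -> W -> Prop).
Variables (f : V -> W) (lev : V -> nat) (r : nat).
Local Open Scope nat_scope.
Hypothesis E_sym : forall x y, E x y -> E y x.
Hypothesis F_sym : forall x y, F x y -> F y x.
Hypothesis f_inj : injective f.
Hypothesis E_lev : forall x y, E x y -> lev y <= (lev x).+1.
Hypothesis fE : forall x y, lev x < r -> E x y <-> F (f x) (f y).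
Hypothesis f_closed : forall x w, lev x < r -> F (f x) w -> exists y, w = f y.

Let peel_lev k x y : peel E k x y -> lev y <= (lev x).+1.
Proof. by move/(peel_le (leq0n k))/E_lev. Qed.

Let peel_closed k x w : lev x < r -> peel F k (f x) w -> exists y, w = f y.
Proof. by move=> xr /(peel_le (leq0n k)); exact: f_closed. Qed.

Let leaves_local k x : lev x < r ->
  (forall y, peel E k x y <-> peel F k (f x) (f y)) ->
  leaves (peel E k) x <-> leaves (peel F k) (f x).
Proof.
move=> xr ek; split=> -[y [xy yu]].
  exists (f y); split; first exact/ek.
  by move=> w xw; have [z wz] := peel_closed xr xw; subst w;
    rewrite (yu z)//; apply/ek.
have [z yz] := peel_closed xr xy; subst y.
by exists z; split; [exact/ek|move=> t /ek /yu /f_inj].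
Qed.

(** Whether the edge from [x] to [y] survives one more peeling depends on the leaves next to [x] or
    [y], at most two levels above [x]; each stage therefore costs two units of the radius [r]. *)
Lemma peel_local k x y : lev x + k.*2 < r ->
  peel E k x y <-> peel F k (f x) (f y).
Proof.
elim: k x y => [|k IH] x y xr /=; first by rewrite fE//; lia.
have leafP z : lev z <= lev x + 2 ->
    leaves (peel E k) z <-> leaves (peel F k) (f z).
  by move=> zx; apply: leaves_local => [|t]; [lia|apply: IH; lia].
split=> -[xy nx]; (split; first by apply/IH => //; lia).
  move=> [w lw wxy]; apply: nx.
  have yx : lev y <= (lev x).+1 := peel_lev xy.
  have [z [wz zx]] : exists z, w = f z /\ lev z <= lev x + 2.
    have lev_le u : lev u <= (lev x).+1 -> peel F k w (f u) ->
        exists z, w = f z /\ lev z <= lev x + 2.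
      move=> ux /(peel_sym F_sym) uw.
      have [|z wz] := peel_closed _ uw; first by lia.
      subst w; exists z; split=> //; have /peel_lev : peel E k u z.
        by apply/IH => //; lia.
      lia.
    by case: wxy => [/lev_le|/lev_le]; apply; lia.
  subst w; exists z; first exact/leafP.
  have zr : lev z + k.*2 < r by lia.
  by case: wxy => /IH ?; [left|right]; auto.
have xy' : peel E k x y by apply/IH => //; lia.
have yx : lev y <= (lev x).+1 := peel_lev xy'.
move=> [z lz zxy]; apply: nx.
have zx : lev z <= lev x + 2.
  by case: zxy => /(peel_sym E_sym)/peel_lev; lia.
exists (f z); first exact/leafP.
by case: zxy => ?; [left|right]; apply/IH => //; lia.
Qed.

Lemma isolated_local k x : lev x + k.*2 < r ->
  isolated (peel E k) x <-> isolated (peel F k) (f x).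
Proof.
move=> xr; split=> xi.
  move=> w xw; have [y wy] : exists y, w = f y by apply: peel_closed xw; lia.
  by subst w; apply: (xi y); apply/peel_local.
by move=> y /(peel_local _ xr); exact: xi.
Qed.

Let leaf_nbr k x : lev x + k.*2.+2 < r ->
  (exists2 v, leaves (peel E k) v & peel E k x v) <->
  (exists2 v, leaves (peel F k) v & peel F k (f x) v).
Proof.
move=> xr; have lP v : lev v <= (lev x).+1 ->
    leaves (peel E k) v <-> leaves (peel F k) (f v).
  by move=> ?; apply: leaves_local => [|t]; [|apply: peel_local]; lia.
have eP v : peel E k x v <-> peel F k (f x) (f v) by apply: peel_local; lia.
split=> -[v lv xv].
  by exists (f v); [apply/lP => //; exact: peel_lev xv|exact/eP].
have [y vy] : exists y, v = f y by apply: peel_closed xv; lia.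
subst v; move/eP in xv; exists y => //.
by apply/lP => //; exact: peel_lev xv.
Qed.

Let leaves_local' k x : lev x + k.*2.+2 < r ->
  leaves (peel E k) x <-> leaves (peel F k) (f x).
Proof.
by move=> xr; apply: leaves_local => [|y]; [|apply: peel_local]; lia.
Qed.

Lemma G_set_local k x : lev x + k.*2.+2 < r ->
  G_set E k x <-> G_set F k (f x).
Proof.
move=> xr; rewrite /G_set /=.
by split=> -[l n]; split; [apply/leaves_local'|apply/leaf_nbr|
  apply/leaves_local'|apply/leaf_nbr].
Qed.

Lemma H_set_local k x : lev x + k.*2.+2 < r ->
  H_set E k x <-> H_set F k (f x).
Proof.
move=> xr; rewrite /H_set /=; have := leaves_local' xr; have := leaf_nbr xr.
by case=> ? ? [? ?]; split=> -[? ?]; split; auto.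
Qed.

(** The margin [k.*2.+2] comes from isolation at stage [k.+1]; the leaves of stage [k] next to [x]
    cost a single unit beyond [k.*2]. *)
Lemma J_set_local k x : lev x + k.*2.+2 < r ->
  J_set E k x <-> J_set F k (f x).
Proof.
move=> xr; rewrite /J_set /=.
have := G_set_local xr; have := H_set_local xr.
have : isolated (peel E k) x <-> isolated (peel F k) (f x).
  by apply: isolated_local; lia.
have : isolated (peel E k.+1) x <-> isolated (peel F k.+1) (f x).
  by apply: isolated_local; lia.
rewrite /= /setD /setU /=; tauto.
Qed.

End PeelLocal.

(** * Rank and nullity *)

Lemma mxrank_diag (F : fieldType) n (d : 'rV[F]_n) :
  \rank (diag_mx d) = #|[pred j | d 0 j != 0]|.
Proof.
rewrite -sum1_card big_mkcond /=; elim: n d => [|n IH] d.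
  by rewrite big_ord0 [diag_mx d]thinmx0 mxrank0.
have dE : d = row_mx (lsubmx (d : 'rV_(1 + n))) (rsubmx (d : 'rV_(1 + n))).
  by rewrite hsubmxK.
rewrite big_ord_recl.
transitivity (\rank (diag_mx (lsubmx (d : 'rV_(1 + n)))) +
              \rank (diag_mx (rsubmx (d : 'rV_(1 + n)))))%N.
  by rewrite -rank_diag_block_mx -diag_mx_row -dE.
rewrite IH; congr (_ + _)%N.
  have -> : diag_mx (lsubmx (d : 'rV_(1 + n))) = (d 0 0)%:M.
    apply/matrixP => i j; rewrite !ord1 !mxE eqxx /= mulr1n; congr (d _ _).
    exact: val_inj.
  have -> : (d 0 0)%:M = d 0 0 *: (1%:M : 'M[F]_1) by rewrite scalemx1.
  rewrite inE; have [->|d0] := eqVneq (d 0 0) 0.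
    by rewrite scale0r mxrank0.
  by rewrite mxrank_scale_nz// mxrank1.
apply: eq_bigr => i _; rewrite !inE !mxE; congr (if d _ _ != 0 then _ else _).
by apply: val_inj.
Qed.

(** Multiplication by this projection clears the columns in [S] on the right and the rows in [S] on
    the left. *)
Definition erase_mx (F : fieldType) n (S : {set 'I_n}) : 'M[F]_n :=
  diag_mx (\row_j (j \notin S)%:R).

(** The kernel of the projection is spanned by the unit rows indexed by [S]; as the row space of [A]
    contains them all, the rank drops by exactly their number. *)
Lemma mxrank_erase (F : fieldType) m n (A : 'M[F]_(m, n)) (S : {set 'I_n}) :
  (forall y, y \in S -> ((delta_mx 0 y : 'rV[F]_n) <= A)%MS) ->
  \rank A = (#|S| + \rank (A *m erase_mx F S))%N.
Proof.
move=> SA; rewrite -(mxrank_mul_ker A (erase_mx F S)) addnC; congr (_ + _)%N.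
have kS : (kermx (erase_mx F S) <= A)%MS.
  apply/row_subP => i; set u := row i _.
  have /sub_kermxP uS : (u <= kermx (erase_mx F S))%MS by exact: row_sub.
  rewrite (row_sum_delta u); apply: summx_sub => j _.
  have [jS|jS] := boolP (j \in S); first exact/scalemx_sub/SA.
  have uj : u 0 j = 0.
    by move/rowP: uS => /(_ j); rewrite mul_mx_diag !mxE jS mulr1.
  by rewrite uj scale0r sub0mx.
have /eqmxP -> : (A :&: kermx (erase_mx F S) == kermx (erase_mx F S))%MS.
  by rewrite capmxSr sub_capmx kS submx_refl.
rewrite mxrank_ker mxrank_diag -[n in (n - _)%N]card_ord -(cardsC S).
have -> : #|[pred j | (\row_j (j \notin S)%:R : 'rV[F]_n) 0 j != 0]| = #|~: S|.
  apply: eq_card => j.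
  by rewrite !inE mxE; case: (j \in S); rewrite ?oner_eq0 ?eqxx.
by rewrite addnK.
Qed.

Lemma mxrank_nz_rows (F : fieldType) n (A : 'M[F]_n) (S : {set 'I_n}) :
  (forall i, i \in S -> row i A = 0) -> (\rank A <= n - #|S|)%N.
Proof.
move=> SA; have -> : A = erase_mx F S *m A.
  apply/row_matrixP => i; apply/rowP => j; rewrite mul_diag_mx !mxE.
  have [iS|iS] := boolP (i \in S); last by rewrite mul1r.
  by move/rowP: (SA _ iS) => /(_ j); rewrite !mxE => ->; rewrite mulr0.
rewrite (leq_trans (mxrankM_maxl _ _))// mxrank_diag.
rewrite -[n in (n - _)%N]card_ord -(cardsC S) addKn subset_leq_card//.
apply/fintype.subsetP => j; rewrite !inE mxE.
by case: (j \in S); rewrite ?eqxx.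
Qed.

Section PeelRank.
Variables (F : fieldType) (n : nat) (E : 'I_n -> 'I_n -> Prop).
Hypothesis E_sym : forall x y, E x y -> E y x.

Definition peel_mx k : 'M[F]_n := \matrix_(i, j) `[< peel E k i j >]%:R.

Definition vset (A : set 'I_n) : {set 'I_n} := [set x | `[< A x >]]%SET.

Lemma in_vset (A : set 'I_n) x : x \in vset A <-> A x.
Proof. by rewrite inE; split=> /asboolP. Qed.

Lemma peel_mx_sym k : (peel_mx k)^T = peel_mx k.
Proof.
apply/matrixP => i j; rewrite !mxE; congr (nat_of_bool _)%:R.
by apply/asboolP/asboolP; exact: peel_sym.
Qed.

Lemma peel_mx_leaf k x y : leaves (peel E k) x -> peel E k x y ->
  row x (peel_mx k) = delta_mx 0 y.
Proof.
move=> [z [xz zu]] xy; apply/rowP => j; rewrite !mxE eqxx /=.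
congr (nat_of_bool _)%:R; apply/asboolP/eqP => [xj|->//].
by rewrite -(zu _ xj) (zu _ xy).
Qed.

Lemma vset_GH k : vset (G_set E k) :&: vset (H_set E k) = finset.set0.
Proof.
apply/setP => x; rewrite finset.in_set0; apply/negP; rewrite inE => /andP[].
by move=> /in_vset[lx _] /in_vset[].
Qed.

Lemma mxrank_peel k : \rank (peel_mx k) =
  (#|vset (G_set E k)| + (#|vset (H_set E k)|).*2 + \rank (peel_mx k.+1))%N.
Proof.
set S := vset (G_set E k) :|: vset (H_set E k).
have SP x : x \in S <-> exists2 v, leaves (peel E k) v & peel E k x v.
  rewrite inE; split=> [/orP[]/in_vset[_]//|lx].
  have [x1|x1] := pselect (leaves (peel E k) x).
    by apply/orP; left; apply/in_vset.
  by apply/orP; right; apply/in_vset.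
rewrite (@mxrank_erase _ _ _ _ S); last first.
  move=> y /SP[v lv /(peel_sym E_sym) vy]; apply: (eq_row_sub v).
  exact: peel_mx_leaf.
have SE : #|S| = (#|vset (G_set E k)| + #|vset (H_set E k)|)%N.
  by rewrite cardsU vset_GH cards0 subn0.
rewrite SE -addnn addnA -[RHS]addnA; congr (_ + _)%N.
(* Transposition turns the cleared columns into cleared rows, and the same lemma then handles
   columns. Only those of [H_set] remain to be cleared: a vertex of [G_set] has its single neighbour
   in [S], so its column is already zero. *)
rewrite -mxrank_tr trmx_mul peel_mx_sym tr_diag_mx.
rewrite (@mxrank_erase _ _ _ _ (vset (H_set E k))); last first.
  move=> y /in_vset[ly [v lv yv]]; apply: (eq_row_sub v).
  have vy := peel_sym E_sym yv.
  rewrite -(peel_mx_leaf lv vy); apply/rowP => j; rewrite mul_diag_mx !mxE.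
  (* The row of the leaf [v] has survived the first clearing: the only neighbour of [v] is [y],
     which is not a leaf. *)
  suff -> : v \notin S by rewrite mul1r.
  apply/negP => /SP[w lw vw]; apply: ly.
  by have [z [_ zu]] := lv; rewrite -(zu _ vy) (zu _ vw).
congr (_ + \rank _)%N; apply/matrixP => i j.
rewrite mul_mx_diag mxE mul_diag_mx !mxE -!natrM !mulnb.
congr (nat_of_bool _)%:R.
apply/idP/asboolP => [/andP[/andP[iS /asboolP ij] jH]|[ij nij]].
  split=> // -[x lx [/(peel_sym E_sym) xi|/(peel_sym E_sym) xj]].
    by move/negP: iS; apply; apply/SP; exists x.
  (* If [j] is itself a leaf, then its neighbour [i] lies in [S], against [iS]; otherwise [j] lies
     in [H_set]. *)
  have [jl|jl] := pselect (leaves (peel E k) j).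
    move/negP: iS; apply; apply/SP; exists j => //.
  by move/negP: jH; apply; apply/in_vset; split=> //; exists x.
have nS x : x = i \/ x = j -> x \notin S.
  move=> xij; apply/negP => /SP[v lv /(peel_sym E_sym) vx]; apply: nij.
  by exists v => //; case: xij vx => ->; [left|right].
rewrite nS; last by left.
apply/andP; split; first by apply/asboolP.
by have := nS j (or_intror erefl); rewrite inE negb_or => /andP[].
Qed.

Lemma card_isolatedS k : #|vset (isolated (peel E k.+1))| =
  (#|vset (isolated (peel E k))| + (#|vset (G_set E k)| +
   (#|vset (H_set E k)| + #|vset (J_set E k)|)))%N.
Proof.
have -> : vset (isolated (peel E k.+1)) = vset (isolated (peel E k)) :|:
    (vset (G_set E k) :|: (vset (H_set E k) :|: vset (J_set E k))).
  apply/setP => x; apply/idP/idP => [/in_vset|].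
    rewrite isolated_peelS// !finset.in_setU.
    by move=> [|[|[|]]] /in_vset ->; rewrite ?orbT.
  rewrite !finset.in_setU => h; apply/in_vset; rewrite isolated_peelS//.
  by move: h => /or4P[]/in_vset; rewrite /setU /=; tauto.
have disj (A B : set 'I_n) : (forall x, A x -> B x -> False) ->
    vset A :&: vset B = finset.set0.
  move=> AB; apply/setP => x; rewrite finset.in_set0; apply/negP; rewrite inE.
  by move=> /andP[/in_vset Ax /in_vset]; exact: AB.
have IG : vset (isolated (peel E k)) :&: vset (G_set E k) = finset.set0.
  by apply: disj => x Ix Gx; exact: G_set_not_isolated Ix.
have IH : vset (isolated (peel E k)) :&: vset (H_set E k) = finset.set0.
  by apply: disj => x Ix Hx; exact: H_set_not_isolated Ix.
have IJ : vset (isolated (peel E k)) :&: vset (J_set E k) = finset.set0.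
  by apply: disj => x Ix [[_]].
have GJ : vset (G_set E k) :&: vset (J_set E k) = finset.set0.
  by apply: disj => x Gx [_]; apply; left.
have HJ : vset (H_set E k) :&: vset (J_set E k) = finset.set0.
  by apply: disj => x Hx [_]; apply; right.
rewrite !cardsU !finset.setIUr vset_GH IG IH IJ GJ HJ.
by rewrite !finset.setU0 cards0 !subn0.
Qed.

(** The difference is exactly the nullity at stage [K] minus the number of isolated vertices, by
    induction on [K]. It is nonnegative because isolated vertices give zero rows, and the upper
    bound is nonnegativity of the rank. *)
Lemma mxrank_nullity_bound (R : realFieldType) K :
  `| (n%:R - (\rank (peel_mx 0))%:R) - (#|vset (isolated (peel E 0))|%:R +
     \sum_(k < K) (#|vset (J_set E k)|%:R - #|vset (H_set E k)|%:R)) |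
  <= n%:R - #|vset (isolated (peel E K))|%:R :> R.
Proof.
have -> : n%:R - (\rank (peel_mx 0))%:R =
    #|vset (isolated (peel E 0))|%:R +
     \sum_(k < K) (#|vset (J_set E k)|%:R - #|vset (H_set E k)|%:R) +
    (n%:R - (\rank (peel_mx K))%:R - #|vset (isolated (peel E K))|%:R) :> R.
  elim: K => [|K ->]; first by rewrite big_ord0; ring.
  rewrite big_ord_recr /= [\rank (peel_mx K)]mxrank_peel card_isolatedS.
  rewrite -addnn !natrD; ring.
rewrite addrC addKr.
have iso : (\rank (peel_mx K) <= n - #|vset (isolated (peel E K))|)%N.
  apply: mxrank_nz_rows => i /in_vset iK; apply/rowP => j; rewrite !mxE.
  by case: asboolP => // /iK.
have nI : (#|vset (isolated (peel E K))| <= n)%N.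
  by rewrite -[leqRHS]card_ord max_card.
have : ((\rank (peel_mx K))%:R <= n%:R - #|vset (isolated (peel E K))|%:R :> R).
  by rewrite -natrB// ler_nat.
have : (0 <= (\rank (peel_mx K))%:R :> R) by [].
by move=> *; rewrite ger0_norm; lra.
Qed.

End PeelRank.

(** * The mass at zero as a normalised nullity *)

Lemma empiricalE (R : realType) (d : measure_display) (X : measurableType d)
    (n : nat) (x : 'I_n.+1 -> X) (A : set X) :
  @empirical R d X n x A =
  (#|[set i | `[< A (x i) >]]%SET|%:R / n.+1%:R)%:E.
Proof.
rewrite /empirical /mscale /msum /= mulrC EFinM; congr (_ * _)%E.
transitivity (\sum_(i < n.+1) (dirac (x (inord i)) A : \bar R))%E; first by [].
under eq_bigr do rewrite diracE.
rewrite sumEFin; congr EFin; rewrite -sum1_card natr_sum.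
rewrite [RHS]big_mkcond /=; apply: eq_bigr => i _.
rewrite inE inord_val; case: asboolP => [Ai|Ai]; first by rewrite mem_set.
by rewrite memNset.
Qed.

Definition rt_rel (t : rooted_tree) : 'I_(rt_pred_size t).+1 ->
  'I_(rt_pred_size t).+1 -> Prop := fun x y => @rt_edge t x y.

Lemma rt_rel_sym (t : rooted_tree) x y : @rt_rel t x y -> rt_rel y x.
Proof. by have [es _ _] := rt_is_tree t; rewrite /rt_rel es. Qed.

(** The spectral theorem makes the rank the number of nonzero entries of [spectral_diag]; these are
    real, so an entry vanishes as soon as its real part does. *)
Lemma mass_at_zeroE (R : realType) (t : utree) : mass_at_zero R t =
  ((rt_pred_size (repr t)).+1%:R -
   (\rank (peel_mx R[i] (@rt_rel (repr t)) 0))%:R) /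
  (rt_pred_size (repr t)).+1%:R.
Proof.
rewrite /mass_at_zero; move: (repr t) => {}t.
rewrite /spectral_distribution empiricalE /=; congr (_ / _).
have -> : peel_mx R[i] (@rt_rel t) 0 = adjacency_matrix R t.
  by apply/matrixP => i j; rewrite !mxE /=;
    case: (asboolP (rt_rel i j)) => [->|/negP/negPf ->].
have herm := adjacency_matrix_hermitian R t.
have dreal := hermitian_spectral_diag_real herm.
have /orthomx_spectralP AE := hermitian_normalmx herm.
set A := adjacency_matrix R t in herm dreal AE *.
rewrite [in \rank _]AE mxrankMfree ?row_free_unit ?spectral_unit//.
rewrite eqmxMfull ?row_full_unit ?unitmx_inv ?spectral_unit// mxrank_diag.
apply/eqP; rewrite -subr_eq0 opprB addrA -natrD subr_eq0; apply/eqP; congr _%:R.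
rewrite -[RHS]card_ord -(cardC [pred j | spectral_diag A 0 j != 0]) addnC.
congr (_ + _)%N; apply: eq_card => i; rewrite !inE negbK.
apply/asboolP/eqP => [|->//].
have := mxOverP dreal ord0 i; move: (spectral_diag A _ i) => [a b].
by rewrite complex_real /= => /eqP -> ->.
Qed.

(** * Fringe decompositions as forests *)

(** The isomorphism is the numbering [label] of the vertices followed by the isomorphism [g] onto
    the chosen representative of the class. *)
Lemma iso_class_repr (V : finType) (e : rel V) (r : V) (et : is_tree e) :
  exists f : V -> rt_vertex (repr (iso_class r et)),
    [/\ bijective f, f r = rt_root (repr (iso_class r et)) &
        forall x y, rt_edge (f x) (f y) = e x y].
Proof.
set t0 : rooted_tree := exist (fun g => `[< is_tree (@rg_edge g) >])
  (relabel e r) (introT (asboolP _) (relabel_is_tree r et)).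
have /eqmodP/asboolP[g [gb groot gE]] :
    (t0 = repr (iso_class r et) %[mod utree])%qT by rewrite reprK.
have V_gt0 : (0 < #|V|)%N by apply/card_gt0P; exists r.
pose label (x : V) : rt_vertex t0 := inord (index x (enum V)).
pose unlabel (i : rt_vertex t0) := nth r (enum V) i.
have labelK : cancel label unlabel.
  move=> x; rewrite /label /unlabel inordK ?nth_index ?mem_enum//.
  by rewrite prednK// cardE index_mem mem_enum.
have unlabelK : cancel unlabel label.
  move=> i; rewrite /label index_uniq ?enum_uniq ?inord_val//.
  by rewrite -cardE; have := ltn_ord i; rewrite [X in (_ < X)%N]prednK.
exists (g \o label); split.
- by apply: bij_comp => //; exists unlabel.
- exact: groot.
- move=> x y /=; rewrite gE /rt_edge /rg_edge /= mxE.
  by rewrite [nth _ _ _]labelK [nth _ _ _]labelK.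
Qed.

(* The forest obtained from a sequence of trees by joining the roots of
   consecutive trees; vertex [(k, a)] is the vertex number [a] of the [k]-th
   tree, and pairs that number no vertex are isolated. *)
Section StarGraph.
Variable s : nat -> option utree.
Implicit Types u v : nat * nat.

Definition star_tree_edge u v := u.1 = v.1 /\
  exists2 t, s u.1 = Some t & exists a b : rt_vertex (repr t),
    [/\ u.2 = a, v.2 = b & rt_edge a b].

Definition star_spine_edge u v := v.1 = u.1.+1 /\ exists t t',
  [/\ s u.1 = Some t, s v.1 = Some t',
      u.2 = rt_root (repr t) & v.2 = rt_root (repr t')].

Definition star_edge u v :=
  [\/ star_tree_edge u v, star_spine_edge u v | star_spine_edge v u].

(** The default number 0 concerns only sequences starting with the adjoined point, which a fringe
    sequence never does. *)
Definition star_root : nat * nat :=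
  (0, if s 0 is Some t then rt_root (repr t) : nat else 0)%N.

Lemma star_edge_sym u v : star_edge u v -> star_edge v u.
Proof.
case=> [[uv [t st [a [b [ua vb ab]]]]]|uv|uv]; last 2 first.
- by apply: Or33.
- by apply: Or32.
apply: Or31; split=> //; exists t; first by rewrite -uv.
by exists b, a; split=> //; have [-> _ _] := rt_is_tree (repr t).
Qed.

Lemma star_edge_level u v : star_edge u v -> (v.1 <= u.1.+1)%N.
Proof. by case=> [[->]|[->]|[->]]; lia. Qed.

End StarGraph.

(** Numbering vertices by pairs gives all sequences the same vertex type, so that forests of
    different sequences can be compared edge by edge. An edge leaving a level below [r] ends at
    level at most [r]. *)
Lemma star_edge_local (r : nat) (s s' : nat -> option utree) u v :
  (forall k, (k <= r)%N -> s k = s' k) -> (u.1 < r)%N ->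
  star_edge s u v <-> star_edge s' u v.
Proof.
move=> ss' ur.
suff imp p q : (forall k, (k <= r)%N -> p k = q k) ->
    star_edge p u v -> star_edge q u v.
  by split; apply: imp => // k kr; rewrite ss'.
move=> pq uv; have vr := star_edge_level uv.
have qu : q u.1 = p u.1 by rewrite pq//; lia.
have qv : q v.1 = p v.1 by rewrite pq//; lia.
by move: uv; rewrite /star_edge /star_tree_edge /star_spine_edge qu qv.
Qed.

Section SinStar.
Variable s : nat -> utree.

Definition sin_pair (u : sin_vertex s) : nat * nat := (tag u, tagged u : nat).

Lemma sin_pair_inj : injective sin_pair.
Proof.
move=> [k a] [l b] [/= kl]; subst l => ab.
by congr existT; exact: val_inj.
Qed.

Lemma sin_pair_edge u v :
  sin_edge u v <-> star_edge (Some \o s) (sin_pair u) (sin_pair v).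
Proof.
move: u v => [k a] [l b]; split.
  case=> /=.
  - move=> [/= kl]; subst l; rewrite tagged_asE /= => ab.
    by apply: Or31; split=> //=; exists (s k) => //; exists a, b.
  - move=> [m [-> ->]]; apply: Or32; split=> //=.
    by exists (s m), (s m.+1).
  - move=> [m [-> ->]]; apply: Or33; split=> //=.
    by exists (s m), (s m.+1).
have root_eq m (c : rt_vertex (repr (s m))) :
    c = rt_root (repr (s m)) :> nat -> existT _ m c = sin_root_at s m.
  by move=> cr; congr existT; exact: val_inj.
case=> /=.
- move=> [/= kl]; subst l => -[_ [<-]] [c [d [/val_inj -> /val_inj -> cd]]].
  by apply: Or31; split=> //=; rewrite tagged_asE.
- move=> [/= lk]; subst l => -[_ [_ [[<-] [<-] ar br]]].
  by apply: Or32; exists k; rewrite !root_eq.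
- move=> [/= lk]; subst k => -[_ [_ [[<-] [<-] ar br]]].
  by apply: Or33; exists l; rewrite !root_eq.
Qed.

Lemma sin_edge_sym (u v : sin_vertex s) : sin_edge u v -> sin_edge v u.
Proof. by rewrite !sin_pair_edge; exact: star_edge_sym. Qed.

Lemma sin_pair_closed u w : star_edge (Some \o s) (sin_pair u) w ->
  exists v, w = sin_pair v.
Proof.
move: u w => [k a] [l b]; case=> /=.
- move=> [/= kl]; subst l => -[_ [<-]] [c [d [_ -> _]]].
  by exists (existT _ k d).
- move=> [/= lk]; subst l => -[_ [_ [_ [<-] _ ->]]].
  by exists (sin_root_at s k.+1).
- move=> [/= lk]; subst k => -[_ [_ [[<-] _ -> _]]].
  by exists (sin_root_at s l).
Qed.

End SinStar.

(** * Paths to the root *)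

Section PathToRoot.
Variable t : rooted_tree.
Implicit Types x y z : rt_vertex t.

Lemma size_path_to_root x : (size (path_to_root x) <= (rt_pred_size t).+1)%N.
Proof.
rewrite -[leqRHS]card_ord -(card_uniqP (path_to_root_uniq x)) max_card//.
Qed.

Lemma path_to_rootE x p : simple_path (@rt_edge t) x (rt_root t) p ->
  path_to_root x = x :: p.
Proof.
move=> xp; rewrite /path_to_root; case: cid => q /= xq; congr cons.
by have [_ _ /(_ x (rt_root t))[r [_ ru]]] := rt_is_tree t;
   rewrite -(ru _ xq) -(ru _ xp).
Qed.

Lemma path_to_root_path x :
  exists p, path_to_root x = x :: p /\ simple_path (@rt_edge t) x (rt_root t) p.
Proof. by rewrite /path_to_root; case: cid => p /= xp; exists p. Qed.

Lemma root_path_to_root x : rt_root t \in path_to_root x.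
Proof. by have [p [-> [_ _ <-]]] := path_to_root_path x; exact: mem_last. Qed.

Lemma path_to_root_root : path_to_root (rt_root t) = [:: rt_root t].
Proof. exact: path_to_rootE. Qed.

Lemma mem_path_to_root x y : x \in path_to_root y ->
  path_to_root x = drop (index x (path_to_root y)) (path_to_root y).
Proof.
move=> xy; have ky : (index x (path_to_root y) < size (path_to_root y))%N.
  by rewrite index_mem.
by rewrite -(path_to_root_drop ky) nth_index.
Qed.

Lemma path_to_root_cons x y : rt_edge x y -> x \notin path_to_root y ->
  path_to_root x = x :: path_to_root y.
Proof.
have [q [yE [yq yu ql]]] := path_to_root_path y.
rewrite yE => xy xp; apply: path_to_rootE; split=> //=.
- by rewrite xy.
- by rewrite xp.
Qed.

Lemma path_to_root_inj : injective (@path_to_root t).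
Proof. by move=> x y; rewrite /path_to_root => -[]. Qed.

(** If each endpoint lay on the path of the other, comparing lengths would force [x = y]; hence one
    of them is off the other's path and can be put in front of it. *)
Lemma path_to_root_edge x y : rt_edge x y ->
  path_to_root x = x :: path_to_root y \/ path_to_root y = y :: path_to_root x.
Proof.
move=> xy; have [es ei _] := rt_is_tree t.
have [xp|] := boolP (x \in path_to_root y); last first.
  by move/(path_to_root_cons xy); left.
have [yp|] := boolP (y \in path_to_root x); last first.
  by rewrite es in xy => /(path_to_root_cons xy); right.
have xE := mem_path_to_root xp; have := mem_path_to_root yp.
rewrite xE => yE.
have i0 : index x (path_to_root y) = 0%N.
  have : (index x (path_to_root y) < size (path_to_root y))%N.
    by rewrite index_mem.
  have := congr1 size yE; rewrite !size_drop; lia.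
by move: xE xy; rewrite i0 drop0 => /path_to_root_inj ->; rewrite ei.
Qed.

End PathToRoot.

Section FringeStar.
Variables (t : rooted_tree) (v : rt_vertex t).
Implicit Types w x y : rt_vertex t.
Let p := path_to_root v.

Lemma spine_index_subproof w :
  (find [pred z | z \in path_to_root w] p < size p)%N.
Proof.
rewrite -has_find; apply/hasP; exists (rt_root t); exact: root_path_to_root.
Qed.

(** The point where the path of [w] joins the path of [v]. The next two lemmas show that it is the
    only [i] for which [spine_part i] contains [w], so that the parts form a partition. *)
Definition spine_index w : 'I_(size p) := Ordinal (spine_index_subproof w).

Lemma spine_index_mem w : w \in spine_part (spine_index w).
Proof.
rewrite inE; apply/andP; split.
  have := @nth_find _ v [pred z | z \in path_to_root w] p; apply.
  by rewrite has_find spine_index_subproof.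
apply/implyP => i0.
have i1 : ((spine_index w).-1 < spine_index w)%N by rewrite ltn_predL.
by have := before_find v i1 => /= ->.
Qed.

(** A path that meets the path of [v] at position [j] follows it from there to the root; were
    [j < i], it would contain the vertex at position [i.-1], which membership in the part
    excludes. *)
Lemma spine_indexP w (i : 'I_(size p)) :
  w \in spine_part i -> spine_index w = i.
Proof.
rewrite inE => /andP[iw niw]; apply: val_inj => /=; apply/eqP.
have le_i : (find [pred z | z \in path_to_root w] p <= i)%N.
  by rewrite leqNgt; apply/negP => /(before_find v) /=; rewrite iw.
rewrite eqn_leq le_i leqNgt; apply/negP => lt_i.
move: niw; rewrite (leq_ltn_trans _ lt_i)//= => /negP; apply.
have := nth_find v (a := [pred z | z \in path_to_root w]) (s := p).
rewrite has_find spine_index_subproof => /(_ isT) /=.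
set j := find _ _ in le_i lt_i * => jw.
have jp : (j < size p)%N by exact: spine_index_subproof.
have := mem_path_to_root jw; rewrite path_to_root_drop// => dE.
apply: (@mem_drop (index (nth v p j) (path_to_root w))).
have ji : (j <= i.-1)%N by rewrite -ltnS prednK// (leq_ltn_trans _ lt_i).
rewrite -dE -(subnKC ji) -nth_drop mem_nth// size_drop ltn_sub2r//.
by rewrite (leq_ltn_trans (leq_pred _)).
Qed.

Definition spine_iso (i : 'I_(size p)) :
    spine_vertex i -> rt_vertex (repr (spine_tree i)) :=
  sval (cid (iso_class_repr (Sub (nth v p i) (spine_root i) : spine_vertex i)
    (spine_is_tree i))).

Lemma spine_isoP (i : 'I_(size p)) : [/\ bijective (@spine_iso i),
  spine_iso (Sub (nth v p i) (spine_root i) : spine_vertex i) =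
    rt_root (repr (spine_tree i)) &
  forall x y : spine_vertex i,
    rt_edge (spine_iso x) (spine_iso y) = @rt_edge t (val x) (val y)].
Proof. by rewrite /spine_iso; case: cid. Qed.

(** Identifies [t] with its image in the forest of the fringe sequence seen from [v]: the lemmas
    below show that it is injective, preserves and reflects edges, has an image closed under
    adjacency and sends [v] to [star_root]. *)
Definition fringe_pair w : nat * nat :=
  (spine_index w : nat,
   spine_iso (Sub w (spine_index_mem w) : spine_vertex (spine_index w)) : nat).

(** Since membership determines the index, the dependent index [spine_index] may be replaced by any
    [i] whose part contains the vertex. *)
Lemma fringe_pairE (i : 'I_(size p)) (x : spine_vertex i) :
  fringe_pair (val x) = (i : nat, spine_iso x : nat).
Proof.
rewrite /fringe_pair; move: (spine_index_mem (val x)).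
rewrite (spine_indexP (valP x)) => m; congr (_, _).
by congr (nat_of_ord (spine_iso _)); exact: val_inj.
Qed.

Lemma fringe_pair_spine (i : 'I_(size p)) :
  fringe_pair (nth v p i) = (i : nat, rt_root (repr (spine_tree i)) : nat).
Proof.
have [_ <- _] := spine_isoP i.
by rewrite -(fringe_pairE (Sub (nth v p i) (spine_root i) : spine_vertex i)).
Qed.

Lemma fringe_pair_surj (i : 'I_(size p)) (b : rt_vertex (repr (spine_tree i))) :
  exists x : spine_vertex i, (i : nat, b : nat) = fringe_pair (val x).
Proof.
have [[g _ gK] _ _] := spine_isoP i.
by exists (g b); rewrite fringe_pairE gK.
Qed.

Lemma fringe_spine_tree (i : 'I_(size p)) : fringe v i = Some (spine_tree i).
Proof. by rewrite /fringe valK. Qed.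

Lemma fringe_Some k u : fringe v k = Some u ->
  exists i : 'I_(size p), k = i /\ u = spine_tree i.
Proof.
rewrite /fringe; case: insubP => //= i _ <- [<-].
by exists i.
Qed.

Lemma fringe_pair_inj : injective fringe_pair.
Proof.
move=> x y xy.
have xE := fringe_pairE (Sub x (spine_index_mem x) : spine_vertex _).
have ym : y \in spine_part (spine_index x).
  by have := spine_index_mem y; rewrite (_ : spine_index y = spine_index x)//;
     apply: val_inj; case: xy.
have := fringe_pairE (Sub y ym : spine_vertex _).
have [[g gK _] _ _] := spine_isoP (spine_index x).
rewrite /= -[LHS]xy [LHS]xE => -[/val_inj /(can_inj gK)].
by move=> /(congr1 val).
Qed.

Lemma fringe_pair_root : fringe_pair v = star_root (fringe v).
Proof.
have p0 : (0 < size p)%N by [].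
have := fringe_pair_spine (Ordinal p0); rewrite /star_root.
by rewrite (fringe_spine_tree (Ordinal p0)) => <-.
Qed.

Lemma path_to_root_nth_edge i : (i.+1 < size p)%N ->
  rt_edge (nth v p i) (nth v p i.+1).
Proof.
have [q [pE [vq _ _]]] := path_to_root_path v.
by rewrite /p pE /= ltnS => iq; move/(pathP v): vq => /(_ i iq).
Qed.

Let spine_edgeE (i j : 'I_(size p)) : j = i.+1 :> nat ->
  star_spine_edge (fringe v)
    (fringe_pair (nth v p i)) (fringe_pair (nth v p j)).
Proof.
move=> ji; rewrite !fringe_pair_spine; split=> //=.
exists (spine_tree i), (spine_tree j).
by rewrite !fringe_spine_tree.
Qed.

Let spine_edge_inv (u w : nat * nat) : star_spine_edge (fringe v) u w ->
  exists i j : 'I_(size p), [/\ j = i.+1 :> nat,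
    u = fringe_pair (nth v p i) & w = fringe_pair (nth v p j)].
Proof.
case: u w => [k a] [l b] [/= lk [tk [tl [/fringe_Some[i [ki tki]]]]]].
move=> /fringe_Some[j [lj tlj]] /= aE bE.
exists i, j; rewrite !fringe_pair_spine -tki -tlj -aE -bE -ki -lj lk.
by split.
Qed.

(** Here [x] is the parent of [y]. If [y] is off the path of [v], both join that path at the same
    place and the edge lies inside one tree; if [y] is on it, so is [x], one step further, and a
    change of index makes the edge a spine edge. *)
Lemma fringe_pair_parent x y : rt_edge x y ->
  path_to_root y = y :: path_to_root x ->
  star_edge (fringe v) (fringe_pair x) (fringe_pair y).
Proof.
move=> xy yE.
have [xy_eq|xy_neq] := eqVneq (spine_index x) (spine_index y).
  have xy_val : (fringe_pair x).1 = (fringe_pair y).1 := congr1 val xy_eq.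
  apply: Or31; split=> //; exists (spine_tree (spine_index y)).
    by rewrite xy_val; exact: fringe_spine_tree.
  have xm := spine_index_mem x; rewrite xy_eq in xm.
  exists (spine_iso (Sub x xm : spine_vertex _)).
  exists (spine_iso (Sub y (spine_index_mem y) : spine_vertex _)).
  have pairE z (zm : z \in spine_part (spine_index y)) :=
    congr1 snd (fringe_pairE (Sub z zm : spine_vertex _)).
  split; [exact: pairE|exact: pairE|].
  by have [_ _ ->] := spine_isoP (spine_index y).
have yp : y \in p.
  apply: contraNT xy_neq => yp; apply/eqP/val_inj.
  apply: (@eq_in_find _ [pred z | z \in path_to_root x]
    [pred z | z \in path_to_root y]) => z zp.
  change ((z \in path_to_root x) = (z \in path_to_root y)).
  by rewrite yE [RHS]in_cons; have [zy|//] := eqVneq z y; rewrite -zy zp in yp.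
have jp : (index y p < size p)%N by rewrite index_mem.
have := mem_path_to_root yp; rewrite (drop_nth v)// nth_index// yE => -[xE].
have j1p : ((index y p).+1 < size p)%N.
  have : (0 < size (path_to_root x))%N by [].
  by rewrite xE size_drop subn_gt0.
have xn : x = nth v p (index y p).+1.
  by move: xE; rewrite (drop_nth v)// => -[].
apply: Or33; rewrite xn -[y in X in star_spine_edge _ X](nth_index v yp).
exact: (spine_edgeE (i := Ordinal jp) (j := Ordinal j1p)).
Qed.

Lemma fringe_pair_edge x y :
  rt_edge x y <-> star_edge (fringe v) (fringe_pair x) (fringe_pair y).
Proof.
have [es _ _] := rt_is_tree t; split.
  move=> xy; have [xE|yE] := path_to_root_edge xy.
    by apply: star_edge_sym; apply: fringe_pair_parent => //; rewrite es.
  exact: fringe_pair_parent.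
case=> [[ixy [u /fringe_Some[i [ki ->]] [a [b [aE bE ab]]]]]||].
- have [x' xE] := fringe_pair_surj a; have [y' yE] := fringe_pair_surj b.
  have xx' : x = val x'.
    apply: fringe_pair_inj; rewrite -xE -ki -aE; by case: (fringe_pair x).
  have yy' : y = val y'.
    apply: fringe_pair_inj; rewrite -yE -ki -bE ixy; by case: (fringe_pair y).
  have [_ _ isoE] := spine_isoP i; rewrite xx' yy' -isoE.
  move: xE yE; rewrite !fringe_pairE => -[/val_inj <-] [/val_inj <-].
  exact: ab.
- move=> /spine_edge_inv[i [j [ij /fringe_pair_inj -> /fringe_pair_inj ->]]].
  by rewrite ij path_to_root_nth_edge// -ij.
- move=> /spine_edge_inv[i [j [ij /fringe_pair_inj -> /fringe_pair_inj ->]]].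
  by rewrite es ij path_to_root_nth_edge// -ij.
Qed.

Lemma fringe_pair_closed x u : star_edge (fringe v) (fringe_pair x) u ->
  exists y, u = fringe_pair y.
Proof.
case=> [[ixy [w /fringe_Some[i [ki ->]] [a [b [aE bE ab]]]]]||].
- have [y yE] := fringe_pair_surj b; exists (val y).
  by rewrite -yE -ki -bE ixy; case: u {ixy bE}.
- by move=> /spine_edge_inv[i [j [_ _ ->]]]; exists (nth v p j).
- by move=> /spine_edge_inv[i [j [_ -> _]]]; exists (nth v p i).
Qed.

End FringeStar.

(** * The single end of a sin-tree *)

Section SinHeight.
Variable s : nat -> utree.

(* Decreases along every edge except the one pointing towards the infinite end
   of the spine. *)
Definition sin_height (u : sin_vertex s) : nat :=
  (\sum_(j < (tag u).+1) (rt_pred_size (repr (s j))).+2 -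
   size (path_to_root (tagged u)))%N.

Lemma sin_height_root k : sin_height (sin_root_at s k) =
  (\sum_(j < k.+1) (rt_pred_size (repr (s j))).+2 - 1)%N.
Proof.
rewrite /sin_height -[1%N]/(size [:: rt_root (repr (s k))]).
congr (_ - size _)%N.
exact: path_to_root_root.
Qed.

Lemma sin_height_edge (x y z : sin_vertex s) : sin_edge x y -> sin_edge x z ->
  y <> z -> (sin_height y < sin_height x)%N \/ (sin_height z < sin_height x)%N.
Proof.
suff [b xb] : exists b, forall c, sin_edge x c -> c <> b ->
    (sin_height c < sin_height x)%N.
  move=> xy xz yz; have [yb|yb] := pselect (y = b); last by left; exact: xb.
  by right; apply: xb => // zb; apply: yz; rewrite yb zb.
move: x => [k a]; have [p [aE _]] := path_to_root_path a.
(* The one neighbour that is not lower is the parent of [a] in its tree or, when [a] is the root of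
   that tree, the next vertex of the spine. *)
exists (if p is a' :: _ then existT _ k a' else sin_root_at s k.+1).
move=> [l c] [].
- move=> [/= kl]; subst l; rewrite tagged_asE => ac cb.
  have cs := size_path_to_root c.
  have [acE|caE] := path_to_root_edge ac; last first.
    apply: ltn_sub2l; last by rewrite caE.
    (* The last summand exceeds the number of vertices of the tree, hence the length of any path in
       it, so the truncated subtraction loses nothing. *)
    rewrite big_ord_recr; apply: (leq_ltn_trans (size_path_to_root a)).
    exact: leq_addl.
  exfalso; apply: cb; move: aE; rewrite acE.
  by have [q [-> _]] := path_to_root_path c => -[<-].
- move=> [m [am cm]]; rewrite cm => cb; exfalso; apply: cb.
  have mk : m = k by have := congr1 tag am.
  subst m; have ar : a = rt_root (repr (s k)).
    by have := congr1 (fun u => tagged_as (sin_root_at s k) u) am;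
       rewrite !tagged_asE.
  by move: aE; rewrite ar path_to_root_root => -[<-].
- move=> [m [-> ->]] _; rewrite !sin_height_root [in ltnRHS]big_ord_recr /=.
  by move: (bigop _ _ _) => N; lia.
Qed.

Lemma sin_root_isolated :
  isolated (peel (@sin_edge s) (sin_height (sin_root s)).+1) (sin_root s).
Proof.
apply: height_isolated; first exact: sin_edge_sym.
exact: sin_height_edge.
Qed.

End SinHeight.

(** * Peeling events on fringe sequences *)

Definition star_isolated k : set star_sequence :=
  [set s | isolated (peel (star_edge s) k) (star_root s)].

Definition star_H k : set star_sequence :=
  [set s | H_set (star_edge s) k (star_root s)].

Definition star_J k : set star_sequence :=
  [set s | J_set (star_edge s) k (star_root s)].

Section FringeEvents.
Variables (t : rooted_tree) (v : rt_vertex t).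

Let rt_rel_fringe (lev : rt_vertex t -> nat) (r : nat) x y : (lev x < r)%N ->
  rt_rel x y <-> star_edge (fringe v) (fringe_pair v x) (fringe_pair v y).
Proof. by move=> _; exact: fringe_pair_edge. Qed.

Let fringe_closed (lev : rt_vertex t -> nat) (r : nat) x u : (lev x < r)%N ->
  star_edge (fringe v) (fringe_pair v x) u -> exists y, u = fringe_pair v y.
Proof. by move=> _; exact: fringe_pair_closed. Qed.

Lemma star_isolated_fringe k :
  star_isolated k (fringe v) <-> isolated (peel (@rt_rel t) k) v.
Proof.
rewrite /star_isolated /= -fringe_pair_root; symmetry.
(* [fringe_pair v] is faithful on the whole tree, so a constant level function serves, with [r] just
   large enough. *)
apply: (isolated_local (lev := fun=> 0%N) (r := k.*2.+1)) => //.
- exact: rt_rel_sym.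
- exact: star_edge_sym.
- exact: fringe_pair_inj.
- exact: rt_rel_fringe.
- exact: fringe_closed.
Qed.

Lemma star_H_fringe k : star_H k (fringe v) <-> H_set (@rt_rel t) k v.
Proof.
rewrite /star_H /= -fringe_pair_root; symmetry.
apply: (H_set_local (lev := fun=> 0%N) (r := k.*2.+3)) => //.
- exact: rt_rel_sym.
- exact: star_edge_sym.
- exact: fringe_pair_inj.
- exact: rt_rel_fringe.
- exact: fringe_closed.
Qed.

Lemma star_J_fringe k : star_J k (fringe v) <-> J_set (@rt_rel t) k v.
Proof.
rewrite /star_J /= -fringe_pair_root; symmetry.
apply: (J_set_local (lev := fun=> 0%N) (r := k.*2.+3)) => //.
- exact: rt_rel_sym.
- exact: star_edge_sym.
- exact: fringe_pair_inj.
- exact: rt_rel_fringe.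
- exact: fringe_closed.
Qed.

End FringeEvents.

Section SinEvents.
Variable s : sin_tree.

Let sin_pairE (lev : sin_vertex s -> nat) (r : nat) x y : (lev x < r)%N ->
  sin_edge x y <-> star_edge (star_embedding s) (sin_pair x) (sin_pair y).
Proof. by move=> _; exact: sin_pair_edge. Qed.

Let sin_closed (lev : sin_vertex s -> nat) (r : nat) x u : (lev x < r)%N ->
  star_edge (star_embedding s) (sin_pair x) u ->
  exists y : sin_vertex s, u = sin_pair y.
Proof. by move=> _; exact: sin_pair_closed. Qed.

Lemma star_isolated_sin k : star_isolated k (star_embedding s) <->
  isolated (peel (@sin_edge s) k) (sin_root s).
Proof.
symmetry.
apply: (isolated_local (f := @sin_pair s) (lev := fun=> 0%N)
  (r := k.*2.+1)) => //.
- exact: sin_edge_sym.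
- exact: star_edge_sym.
- exact: sin_pair_inj.
- exact: sin_pairE.
- exact: sin_closed.
Qed.

Lemma star_H_sin k : star_H k (star_embedding s) <->
  H_set (@sin_edge s) k (sin_root s).
Proof.
symmetry.
apply: (H_set_local (f := @sin_pair s) (lev := fun=> 0%N) (r := k.*2.+3)) => //.
- exact: sin_edge_sym.
- exact: star_edge_sym.
- exact: sin_pair_inj.
- exact: sin_pairE.
- exact: sin_closed.
Qed.

Lemma star_J_sin k : star_J k (star_embedding s) <->
  J_set (@sin_edge s) k (sin_root s).
Proof.
symmetry.
apply: (J_set_local (f := @sin_pair s) (lev := fun=> 0%N) (r := k.*2.+3)) => //.
- exact: sin_edge_sym.
- exact: star_edge_sym.
- exact: sin_pair_inj.
- exact: sin_pairE.
- exact: sin_closed.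
Qed.

End SinEvents.

Section StarLocal.
Variables (s s' : star_sequence) (r : nat).
Hypothesis ss' : forall k, (k <= r)%N -> s k = s' k.

Let root_eq : star_root s' = star_root s.
Proof. by rewrite /star_root ss'. Qed.

Let edge_eq (u v : nat * nat) : (u.1 < r)%N ->
  star_edge s u v <-> star_edge s' u v.
Proof. exact: star_edge_local. Qed.

Let closed (u w : nat * nat) : (u.1 < r)%N -> star_edge s' u w ->
  exists v, w = id v.
Proof. by exists w. Qed.

Lemma star_isolated_local k : (k.*2 < r)%N ->
  star_isolated k s <-> star_isolated k s'.
Proof.
move=> kr; rewrite /star_isolated /= root_eq.
(* Here the level is the index of the tree: the two forests share their vertices but are known to
   agree only below level [r], and the root has level 0. *)
apply: (isolated_local (f := id) (lev := fst) (r := r)) => //.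
- exact: star_edge_sym.
- exact: star_edge_sym.
- exact: star_edge_level.
Qed.

Lemma star_H_local k : (k.*2.+2 < r)%N -> star_H k s <-> star_H k s'.
Proof.
move=> kr; rewrite /star_H /= root_eq.
apply: (H_set_local (f := id) (lev := fst) (r := r)) => //.
- exact: star_edge_sym.
- exact: star_edge_sym.
- exact: star_edge_level.
Qed.

Lemma star_J_local k : (k.*2.+2 < r)%N -> star_J k s <-> star_J k s'.
Proof.
move=> kr; rewrite /star_J /= root_eq.
apply: (J_set_local (f := id) (lev := fst) (r := r)) => //.
- exact: star_edge_sym.
- exact: star_edge_sym.
- exact: star_edge_level.
Qed.

End StarLocal.

(** Prescribing the coordinates up to [r] is a finite intersection of preimages of points of a
    discrete space, hence a neighbourhood in the product topology. *)
Lemma star_determined_open (A : set star_sequence) (r : nat) :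
  (forall s s' : star_sequence, (forall k, (k <= r)%N -> s k = s' k) ->
    A s -> A s') -> open A.
Proof.
move=> Ar; rewrite openE => s As.
have proj k : nbhs s [set s' : star_sequence | s k = s' k].
  have := @proj_continuous _ (fun=> utree_star) k s [set x | s k = x]; apply.
  exact/principal_filterP.
suff : nbhs s [set s' : star_sequence | forall k, (k <= r)%N -> s k = s' k].
  by apply: filterS => s' ss'; exact: Ar As.
elim: r {Ar} => [|r IH].
  by apply: filterS (proj 0%N) => s' s0 k; rewrite leqn0 => /eqP ->.
apply: filterS2 IH (proj r.+1) => s' ss' sr k.
by rewrite leq_eqVlt => /predU1P[->//|]; exact: ss'.
Qed.

Lemma star_determined_clopen (A : set star_sequence) (r : nat) :
  (forall s s' : star_sequence, (forall k, (k <= r)%N -> s k = s' k) ->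
    A s <-> A s') -> clopen A.
Proof.
move=> Ar; split.
  by apply: (star_determined_open (r := r)) => s s' /Ar[].
rewrite -openC; apply: (star_determined_open (r := r)) => s s' /Ar ss' nAs As'.
by apply: nAs; apply/ss'.
Qed.

Lemma clopen_star_isolated k : clopen (star_isolated k).
Proof.
apply: (star_determined_clopen (r := k.*2.+1)) => s s' ss'.
exact: (star_isolated_local ss').
Qed.

Lemma clopen_star_H k : clopen (star_H k).
Proof.
apply: (star_determined_clopen (r := k.*2.+3)) => s s' ss'.
exact: (star_H_local ss').
Qed.

Lemma clopen_star_J k : clopen (star_J k).
Proof.
apply: (star_determined_clopen (r := k.*2.+3)) => s s' ss'.
exact: (star_J_local ss').
Qed.

(** * Weak convergence *)

(** The codomain carries the standard sigma-algebra of the reals, generated by open intervals,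
    instead of [borel R]; integration requires this version. *)
Lemma continuous_borel_real (R : realType) (S : ptopologicalType) (f : S -> R) :
  continuous f -> measurable_fun [set: borel S] (f : borel S -> R).
Proof.
move=> /continuousP fc; apply: (measurability _ (RGenOpens.measurableE R)).
move=> _ [_ [a [b ->] <-]]; rewrite setTI; apply: sub_sigma_algebra.
exact/fc/interval_open.
Qed.

Lemma cvg_initial (S : choiceType) (T : topologicalType) (f : S -> T)
    (F : set_system S) (s : S) : Filter F ->
  F --> (s : initial_topology f) <-> f @ F --> f s.
Proof.
move=> FF; split=> [Fs|fFs].
  exact: (cvg_comp _ f Fs (@initial_continuous _ _ f s)).
move=> A /= [_ [[B Bop <-] Bs sBA]].
have Bnbhs : nbhs (f s) B by exact: open_nbhs_nbhs.
exact: filterS sBA (fFs _ Bnbhs).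
Qed.

Lemma cvg_ptws (U : eqType) (V : topologicalType) (F : set_system {ptws U -> V})
    (f : {ptws U -> V}) : Filter F ->
  F --> f <-> forall u, (fun g : {ptws U -> V} => g u) @ F --> f u.
Proof.
move=> FF; split=> [Ff u|Ff].
  exact: (cvg_comp _ _ Ff (@proj_continuous _ (fun=> V) u f)).
by apply/cvg_sup => u; apply/cvg_initial; exact: Ff.
Qed.

Section LawSpace.
Variables (R : realType) (S : ptopologicalType).
Implicit Types (f : bounded_continuous R S).

Lemma cvg_law (mu_ : nat -> law_space R S) (mu : law_space R S) :
  mu_ n @[n --> \oo] --> mu <->
  forall f, integral_functionals (mu_ n) f @[n --> \oo] -->
            integral_functionals mu f.
Proof.
rewrite cvg_initial cvg_ptws; split=> h f; exact: h.
Qed.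

Lemma bounded_continuous_measurable f :
  measurable_fun [set: borel S] (EFin \o (sval f : borel S -> R)).
Proof.
by apply/measurable_EFinP; apply: continuous_borel_real; case: f => g [].
Qed.

Lemma bounded_continuous_integrable (d : measure_display)
    (Om : measurableType d) (P : probability Om R) (X : Om -> S) f :
  measurable_fun setT (X : Om -> borel S) ->
  P.-integrable setT (EFin \o (sval f \o X)).
Proof.
move=> mX; case: f => f [fc fb] /=; apply: measurable_bounded_integrable => //.
- exact: le_lt_trans (probability_le1 P measurableT) (ltry _).
- by apply: measurableT_comp mX; exact: continuous_borel_real.
- have [M [Mr Mf]] := fb; exists M; split=> // x Mx w _ /=.
  exact: (Mf x Mx (X w)).
Qed.

Lemma integral_law (d : measure_display) (Om : measurableType d)
    (P : probability Om R) (X : {mfun Om >-> borel S}) f :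
  integral_functionals (law P X) f = (\int[P]_w sval f (X w))%R.
Proof.
rewrite /integral_functionals /law /distribution /Rintegral; congr fine.
rewrite integral_pushforward//.
- exact: bounded_continuous_measurable.
- exact: bounded_continuous_integrable.
Qed.

Lemma integral_point_law (x : S) f :
  integral_functionals (point_law R x) f = sval f x.
Proof.
rewrite /integral_functionals /point_law /Rintegral integral_dirac//.
  by rewrite diracE in_setT mul1e.
exact: bounded_continuous_measurable.
Qed.

Lemma clopen_borel (C : set S) : clopen C -> measurable (C : set (borel S)).
Proof. by move=> [oC _]; exact: sub_sigma_algebra. Qed.

Lemma indic_clopen (C : set S) : clopen C -> continuous (\1_C : S -> R).
Proof.
move=> [oC cC] x; apply: (@cvg_trans _ (cst (\1_C x : R) @ x)).
  2: exact: cvg_cst.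
apply: near_eq_cvg; have [xC|xC] := pselect (C x).
  have := open_nbhs_nbhs (conj oC xC); apply: filterS => y Cy.
  by rewrite /cst !indicE !mem_set.
have oC' : open (~` C) by rewrite openC.
have := open_nbhs_nbhs (conj oC' xC); apply: filterS => y Cy.
by rewrite /cst !indicE !memNset.
Qed.

Definition law_mass (mu : law_space R S) (C : set S) : R :=
  fine ((mu : probability (borel S) R) C).

(** The indicator of a clopen set is a bounded continuous function, so this mass is one of the
    coordinates that define the topology of [law_space]. *)
Lemma continuous_law_mass (C : set S) : clopen C -> continuous (law_mass ^~ C).
Proof.
move=> cC; have fP : continuous (\1_C : S -> R) /\ bounded_fun (\1_C : S -> R).
  split; first exact: indic_clopen.
  exists 1; split=> // x x1 y _ /=.
  by rewrite indicE normr_nat; apply: (le_trans _ (ltW x1)); case: (_ \in _).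
pose f : bounded_continuous R S := exist _ _ fP.
have -> : law_mass ^~ C =
    (fun phi : {ptws bounded_continuous R S -> R} => phi f) \o
      (@integral_functionals R S : law_space R S -> _).
  apply/funext => mu; rewrite /= /law_mass /integral_functionals /Rintegral.
  rewrite (_ : sval f = \1_C)// integral_indic ?setIT//.
  exact: clopen_borel.
move=> mu; apply: continuous_comp; first exact: initial_continuous.
exact: (@proj_continuous _ (fun=> R)).
Qed.

Lemma law_massE (mu : law_space R S) (C : set S) : clopen C ->
  ((law_mass mu C)%:E = (mu : probability (borel S) R) C)%E.
Proof. by move=> /clopen_borel mC; rewrite fineK// fin_num_measure. Qed.

Lemma law_mass_ge0 (mu : law_space R S) (C : set S) : 0 <= law_mass mu C.
Proof. exact: fine_ge0. Qed.

Lemma law_mass_le1 (mu : law_space R S) (C : set S) : clopen C ->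
  law_mass mu C <= 1.
Proof.
move=> cC; rewrite -lee_fin law_massE//.
by apply: probability_le1; exact: clopen_borel.
Qed.

Lemma law_mass_le (mu : law_space R S) (C D : set S) : clopen C -> clopen D ->
  C `<=` D -> law_mass mu C <= law_mass mu D.
Proof.
move=> cC cD CD; rewrite -lee_fin !law_massE//.
by apply: le_measure; rewrite ?inE//; exact: clopen_borel.
Qed.

Lemma law_massU (mu : law_space R S) (C D : set S) : clopen C -> clopen D ->
  C `&` D = set0 -> law_mass mu (C `|` D) = law_mass mu C + law_mass mu D.
Proof.
move=> cC cD CD; apply: EFin_inj.
rewrite EFinD !law_massE//; last exact: clopenU.
by rewrite measureU//; exact: clopen_borel.
Qed.

Lemma law_mass_dist_le1 (mu nu : law_space R S) (C : set S) : clopen C ->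
  `|law_mass mu C - law_mass nu C| <= 1.
Proof.
move=> cC; rewrite ler_norml.
have := law_mass_le1 mu cC; have := law_mass_ge0 mu C.
by have := law_mass_le1 nu cC; have := law_mass_ge0 nu C; lra.
Qed.

End LawSpace.

(** * Approximation of the mass at zero by fringe masses *)

Lemma fringe_massE (R : realType) (t : utree) (C : set star_sequence)
    (A : set 'I_(rt_pred_size (repr t)).+1) :
  (forall v, C (@fringe (repr t) v) <-> A v) ->
  law_mass (fringe_distribution R t) C =
  #|vset A|%:R / (rt_pred_size (repr t)).+1%:R.
Proof.
move=> CA; rewrite /law_mass /fringe_distribution /= empiricalE /=.
congr (_%:R / _).
by apply: eq_card => v; rewrite !inE; apply/asboolP/asboolP; apply CA.
Qed.

(* The two sides differ by the proportion of zero eigenvalues that the forest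
   left after [K] peelings owes to its non-isolated vertices. *)
Lemma mass_at_zero_approx (R : realType) (t : utree) (K : nat) :
  `| mass_at_zero R t - (law_mass (fringe_distribution R t) (star_isolated 0) +
       \sum_(k < K) (law_mass (fringe_distribution R t) (star_J k) -
                     law_mass (fringe_distribution R t) (star_H k))) |
  <= 1 - law_mass (fringe_distribution R t) (star_isolated K).
Proof.
rewrite !(fringe_massE _ (@star_isolated_fringe (repr t) ^~ _)).
under eq_bigr => k _.
  rewrite (fringe_massE _ (@star_J_fringe (repr t) ^~ k)).
  rewrite (fringe_massE _ (@star_H_fringe (repr t) ^~ k)) -mulrBl.
  over.
rewrite -mulr_suml -mulrDl mass_at_zeroE -mulrBl.
have n0 : 0 < (rt_pred_size (repr t)).+1%:R :> R by [].
rewrite -[X in _ <= X - _](@mulfV _ (rt_pred_size (repr t)).+1%:R) ?gt_eqF//.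
rewrite -mulrBl normrM [`|_^-1|]gtr0_norm ?invr_gt0// ler_pM2r ?invr_gt0//.
apply: mxrank_nullity_bound; exact: rt_rel_sym.
Qed.

Lemma bounded_funP (R : realType) (T : Type) (f : T -> R) :
  bounded_fun f <-> exists M, forall x, `|f x| <= M.
Proof.
split=> [[M [Mr Mf]]|[M Mf]].
  exists (`|M| + 1) => x; apply: (Mf (`|M| + 1) _ x) => //.
  by rewrite ltr_pwDr// ler_norm.
exists M; split; first exact: num_real.
by move=> N /ltW MN x _; exact: le_trans (Mf x) MN.
Qed.

(* A bounded continuous [g] satisfies [|g x - g c| <= e + A |x - c|] for some
   [A], which turns the domination of [|X_n - c|] into one of the integrals. *)
Lemma cvg_law_point (R : realType) (S : ptopologicalType)
    (d : nat -> measure_display) (Om : forall n, measurableType (d n))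
    (P : forall n, probability (Om n) R)
    (Y : forall n, {mfun Om n >-> borel S}) (y : S)
    (X : forall n, {mfun Om n >-> borel R}) (c : R) :
  law (P n) (Y n) @[n --> \oo] --> point_law R y ->
  (forall e, 0 < e -> exists F : S -> R,
    [/\ continuous F, bounded_fun F, F y <= e &
        forall n w, `|c - X n w| <= F (Y n w)]) ->
  law (P n) (X n) @[n --> \oo] --> point_law R c.
Proof.
move=> /cvg_law Ycvg XF; apply/cvg_law => g.
rewrite integral_point_law.
under eq_fun do rewrite integral_law.
apply/cvgrPdist_le => e e0.
have [gc /bounded_funP gb] := svalP g.
have [M gM] : exists M : R, forall x : R, `|sval g x| <= M := gb.
have e4 : 0 < e / 4 by rewrite divr_gt0.
have [D /= D0 gD] : exists2 D, 0 < D &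
    forall x, `|c - x| < D -> `|sval g c - sval g x| <= e / 4.
  have /cvgrPdist_le/(_ _ e4)/nbhs_ballP[D /= D0 gD] := gc c.
  by exists D => // x xD; exact: gD.
(* Within distance [D] of [c] continuity gives [e / 4]; beyond it, the oscillation [M + M] is at
   most [A] times the distance. *)
pose A := (M + M) / D.
have M0 : 0 <= M by exact: le_trans (normr_ge0 _) (gM 0).
have A0 : 0 <= A by rewrite divr_ge0 ?addr_ge0// ltW.
have gA x : `|sval g c - sval g x| <= e / 4 + A * `|c - x|.
  have [xD|xD] := ltP `|c - x| D.
    by rewrite (le_trans (gD _ xD))// lerDl mulr_ge0.
  rewrite (le_trans (ler_normB _ _))// (le_trans (lerD (gM c) (gM x)))//.
  rewrite -[leLHS]add0r lerD ?(ltW e4)// /A mulrAC ler_pdivlMr//.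
  by rewrite ler_wpM2l ?addr_ge0.
(* This tolerance gives [A * F y <= e / 4]; adding 1 keeps the denominator positive when [A] is
   0. *)
have eA : 0 < e / 4 / (A + 1) by rewrite divr_gt0// ltr_wpDl.
have [F [Fc Fb Fy XFY]] := XF _ eA.
(* The test function for the laws of [Y n]: it dominates the deviation of [sval g] along [X n], and
   its value at [y] is below [e]. *)
have hP : continuous (fun s => e / 4 + A * F s) /\
    bounded_fun (fun s => e / 4 + A * F s).
  split.
    by move=> s; apply: cvgD; [exact: cvg_cst|
      apply: cvgM; [exact: cvg_cst|exact: Fc]].
  move/bounded_funP: Fb => [N FN]; apply/bounded_funP.
  exists (e / 4 + A * N) => s; rewrite (le_trans (ler_normD _ _))//.
  by rewrite gtr0_norm// lerD2l normrM ger0_norm// ler_wpM2l.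
pose h : bounded_continuous R S := exist _ _ hP.
have hy : sval h y < e.
  have : A * F y <= e / 4.
    rewrite (le_trans (ler_wpM2l A0 Fy))// mulrCA ler_piMr ?(ltW e4)//.
    by rewrite ler_pdivrMr ?mul1r ?lerDl// ltr_wpDl.
  by rewrite /=; lra.
have := Ycvg h; rewrite integral_point_law.
under eq_fun do rewrite integral_law.
move=> /cvgr_lt /(_ _ hy); apply: filterS => n /ltW; apply: le_trans.
have gi : (P n).-integrable setT (EFin \o (sval g \o X n)).
  exact: bounded_continuous_integrable.
have hi : (P n).-integrable setT (EFin \o (sval h \o Y n)).
  exact: bounded_continuous_integrable.
have ci : (P n).-integrable setT (EFin \o (fun=> sval g c)).
  exact: finite_measure_integrable_cst.
have cE : (\int[P n]_w (fun=> sval g c) w)%R = sval g c.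
  rewrite Rintegral_cst// -[RHS]mulr1; congr (_ * _).
  exact: (congr1 fine (probability_setT (P n))).
rewrite -[in leLHS]cE -RintegralB//.
have Bi : (P n).-integrable setT (EFin \o (fun w => sval g c - sval g (X n w))).
  exact: (integrableB measurableT ci gi).
rewrite (le_trans (le_normr_Rintegral _ Bi))//; apply: le_Rintegral => //.
  exact: (integrable_norm Bi).
move=> w _; rewrite (le_trans (gA _))//= lerD2l ler_wpM2l//.
Qed.

(** * Passage to the limit *)

Section SinLaw.
Variables (R : realType) (d : measure_display) (Om : measurableType d).
Variables (P : probability Om R) (T : {mfun Om >-> borel sin_tree}).

Let nu : law_space R star_sequence := law P (star_embedding \o T).

Let nuE (C : set star_sequence) : law_mass nu C =
  fine (P [set w | C (star_embedding (T w))]).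
Proof. by []. Qed.

Lemma sin_law_J k : law_mass nu (star_J k) =
  fine (P [set w | J_set (@sin_edge (T w)) k (sin_root (T w))]).
Proof.
rewrite nuE; congr (fine (P _)); apply/seteqP.
by split=> w /=; apply star_J_sin.
Qed.

Lemma sin_law_H k : law_mass nu (star_H k) =
  fine (P [set w | H_set (@sin_edge (T w)) k (sin_root (T w))]).
Proof.
rewrite nuE; congr (fine (P _)); apply/seteqP.
by split=> w /=; apply star_H_sin.
Qed.

(** The root of a sin-tree is adjacent to the next vertex of the spine. The initial term of the
    nullity formula thus disappears in the limit. *)
Lemma sin_law_isolated0 : law_mass nu (star_isolated 0) = 0.
Proof.
rewrite nuE (_ : [set w | _] = set0) ?measure0//.
apply/seteqP; split=> // w /star_isolated_sin /=.
by move=> /(_ (sin_root_at (T w) 1)); apply; apply: Or32; exists 0%N.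
Qed.

Let star_isolated_le k m : (k <= m)%N -> star_isolated k `<=` star_isolated m.
Proof. by move=> km s; exact: isolated_le. Qed.

(** The events increase with [k] and exhaust the sample space by [sin_root_isolated], so continuity
    of [P] from below applies. *)
Lemma cvg_sin_law_isolated :
  law_mass nu (star_isolated k) @[k --> \oo] --> (1 : R).
Proof.
pose F k := [set w | star_isolated k (star_embedding (T w))].
have mF k : measurable (F k).
  have := clopen_borel (clopen_star_isolated k); rewrite -[F k]setTI.
  exact: (measurable_funP (star_embedding \o T)).
have mU : measurable (\bigcup_k F k) by exact: bigcup_measurable.
have ndF : nondecreasing_seq F.
  by move=> k m km; apply/subsetPset => w; exact: star_isolated_le.
have FT : \bigcup_k F k = setT.
  apply/seteqP; split=> // w _; exists (sin_height (sin_root (T w))).+1 => //=.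
  exact/star_isolated_sin/sin_root_isolated.
have := nondecreasing_cvg_mu (mu := P) mF mU ndF; rewrite FT.
have PT : P setT = 1%:E := probability_setT P.
by move=> h; apply: fine_cvg; apply: cvg_trans h _; rewrite -PT.
Qed.

(** The events [star_J k], [star_H k] and [star_isolated k] are pairwise disjoint and all contained
    in [star_isolated k.+1]. *)
Lemma sin_law_HJ k : law_mass nu (star_J k) + law_mass nu (star_H k) <=
  law_mass nu (star_isolated k.+1) - law_mass nu (star_isolated k).
Proof.
have cI := clopen_star_isolated; have cH := clopen_star_H.
have cJ := clopen_star_J; rewrite lerBrDr -!law_massU//.
- apply: law_mass_le => //; first by apply: clopenU; [exact: clopenU|].
  move=> s [[Js|Hs]|Is].
  + by have [[Is _] _] := Js.
  + by apply: H_set_isolated Hs; exact: star_edge_sym.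
  + exact: star_isolated_le Is.
- exact: clopenU.
- apply/seteqP; split=> // s [[Js|Hs] Is].
    by have [[_ nIs] _] := Js; exact: nIs Is.
  exact: H_set_not_isolated Hs Is.
- apply/seteqP; split=> // s [Js Hs]; have [_] := Js; apply; right; exact: Hs.
Qed.

Lemma cvg_sin_law_series :
  cvgn (series (fun k => law_mass nu (star_J k) - law_mass nu (star_H k))).
Proof.
apply: normed_cvg.
apply: (@series_le_cvg _ _ (fun k =>
  law_mass nu (star_isolated k.+1) - law_mass nu (star_isolated k))).
- by move=> k; exact: normr_ge0.
- move=> k; apply: le_trans (sin_law_HJ k).
  by rewrite addr_ge0 ?law_mass_ge0.
- move=> k; apply: le_trans (sin_law_HJ k).
  by rewrite (le_trans (ler_normB _ _))// !ger0_norm ?law_mass_ge0.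
have -> : series (fun k => law_mass nu (star_isolated k.+1) -
    law_mass nu (star_isolated k)) = (fun n => law_mass nu (star_isolated n)).
  apply/funext => n; rewrite /series /= telescope_sumr// sin_law_isolated0.
  by rewrite subr0.
exact: cvgP cvg_sin_law_isolated.
Qed.

End SinLaw.

Section Deviation.
Variables (R : realType) (nu : law_space R star_sequence) (K : nat) (c : R).

(** Plays the part of [F] in [cvg_law_point]: a bounded continuous function of the law, equal to [c]
    at [nu], where [c] absorbs the errors of truncation at [K]. The range [K.+1] reaches the event
    [star_isolated K], which controls one of these errors. *)
Definition deviation (mu : law_space R star_sequence) : R :=
  let dist C := `|law_mass mu C - law_mass nu C| in
  dist (star_isolated 0) + \sum_(k < K.+1)
    (dist (star_isolated k) + (dist (star_J k) + dist (star_H k))) + c.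

Let dist_continuous C : clopen C ->
  continuous (fun mu : law_space R star_sequence =>
    `|law_mass mu C - law_mass nu C|).
Proof.
move=> cC mu; have cmu := continuous_law_mass cC (x := mu).
exact: (cvg_norm (cvgB cmu (cvg_cst (law_mass nu C)))).
Qed.

Lemma continuous_deviation : continuous deviation.
Proof.
move=> mu; have dI k := dist_continuous (clopen_star_isolated k) (x := mu).
have dJ k := dist_continuous (clopen_star_J k) (x := mu).
have dH k := dist_continuous (clopen_star_H k) (x := mu).
apply: (cvgD (cvgD (dI 0%N) _) (cvg_cst c)).
apply: cvg_big => [|k _]; first exact: add_continuous.
exact: (cvgD (dI k) (cvgD (dJ k) (dH k))).
Qed.

Lemma bounded_deviation : bounded_fun deviation.
Proof.
apply/bounded_funP; exists (1 + \sum_(k < K.+1) (1 + (1 + 1)) + `|c|) => mu.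
rewrite (le_trans (ler_normD _ _))// lerD2r.
have dist1 C : clopen C -> `|law_mass mu C - law_mass nu C| <= 1.
  exact: law_mass_dist_le1.
rewrite ger0_norm; last first.
  by rewrite addr_ge0// sumr_ge0// => k _; rewrite !addr_ge0.
apply: lerD; first by apply: dist1; exact: clopen_star_isolated.
apply: ler_sum => k _; apply: lerD.
  by apply: dist1; exact: clopen_star_isolated.
apply: lerD; first by apply: dist1; exact: clopen_star_J.
by apply: dist1; exact: clopen_star_H.
Qed.

Lemma deviation_self : deviation nu = c.
Proof.
rewrite /deviation big1 => [|k _]; by rewrite !subrr !normr0 ?addr0 ?add0r.
Qed.

End Deviation.

Theorem proposition6p7 (R : realType)
    (d : nat -> measure_display) (Om : forall n, measurableType (d n))
    (P : forall n, probability (Om n) R)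
    (T : forall n, {mfun Om n >-> borel utree})
    (d' : measure_display) (Om' : measurableType d') (P' : probability Om' R)
    (T' : {mfun Om' >-> borel sin_tree})
    (T_cvg : probability_fringe_cvg P T P' T') :
  let u : R^nat := fun k =>
    fine (P' [set w | J_set (@sin_edge (T' w)) k (sin_root (T' w))]) -
    fine (P' [set w | H_set (@sin_edge (T' w)) k (sin_root (T' w))]) in
  cvgn (series u) /\
  law (P n) (@mass_at_zero R \o T n) @[n --> \oo] -->
    point_law R (limn (series u)).
Proof.
move=> u; pose nu : law_space R star_sequence := law P' (star_embedding \o T').
have uE : u = (fun k => law_mass nu (star_J k) - law_mass nu (star_H k)).
  by apply/funext => k; rewrite sin_law_J sin_law_H.
have u_cvg : cvgn (series u) by rewrite uE; exact: cvg_sin_law_series.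
split=> //; apply: (cvg_law_point T_cvg) => e e0.
have e2 : 0 < e / 2 by rewrite divr_gt0.
(* A common [K] for both truncation errors: the tail of the series, and the limiting probability
   that the root is not yet isolated. *)
have [K [uK IK]] : exists K, `|limn (series u) - series u K| <= e / 2 /\
    1 - law_mass nu (star_isolated K) <= e / 2.
  have /cvgrPdist_le/(_ _ e2) h1 := u_cvg.
  have /cvgrPdist_le/(_ _ e2) h2 := @cvg_sin_law_isolated R _ _ P' T'.
  have [K _ hK] := filterI h1 h2; exists K; have [h3 h4] := hK K (leqnn K).
  by split=> //; exact: le_trans (ler_norm _) h4.
exists (deviation nu K e); split.
- exact: continuous_deviation.
- exact: bounded_deviation.
- by rewrite deviation_self.
move=> n w; set mu := (X in deviation _ _ _ X); set t := T n w.
have -> : mu = fringe_distribution R t by [].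
rewrite /deviation.
move: (fringe_distribution R t) (mass_at_zero_approx R t K) => {}mu.
move=> approx.
(* The error splits into the tail of the series, the change from [nu] to [mu] in the partial sum,
   the mass of [star_isolated 0], and the remainder in [approx], which is at most [e / 2 + D K]. *)
pose X := \sum_(k < K) (law_mass mu (star_J k) - law_mass mu (star_H k)).
pose S1 := \sum_(k < K)
  (`|law_mass mu (star_J k) - law_mass nu (star_J k)| +
   `|law_mass mu (star_H k) - law_mass nu (star_H k)|).
have series_dist : `|series u K - X| <= S1.
  rewrite /series /= big_mkord uE -sumrB (le_trans (ler_norm_sum _ _ _))//.
  apply: ler_sum => k _; set a := law_mass mu _; set b := law_mass mu _.
  set p := law_mass nu _; set q := law_mass nu _.
  rewrite [X in `|X|](_ : _ = (p - a) + (b - q)); last by ring.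
  by rewrite (le_trans (ler_normD _ _))// [`|p - a|]distrC.
pose D k : R :=
  `|law_mass mu (star_isolated k) - law_mass nu (star_isolated k)|.
pose S2 := \sum_(k < K.+1) (D k +
  (`|law_mass mu (star_J k) - law_mass nu (star_J k)| +
   `|law_mass mu (star_H k) - law_mass nu (star_H k)|)).
have S12 : D K + S1 <= S2.
  rewrite /S2 big_ord_recr /= addrC lerD ?lerDl ?addr_ge0 ?normr_ge0//.
  by apply: ler_sum => k _; rewrite lerDr normr_ge0.
have DK : law_mass nu (star_isolated K) - law_mass mu (star_isolated K) <= D K.
  by rewrite /D distrC ler_norm.
have D0 : `|law_mass mu (star_isolated 0)| <= D 0%N.
  by rewrite /D sin_law_isolated0 subr0.
change (`|limn (series u) - mass_at_zero R t| <= D 0%N + S2 + e).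
move: approx uK series_dist D0; rewrite -/X !ler_norml.
move: (limn (series u)) (mass_at_zero R t : R) (series u K) IK DK S12 => l z uK.
move: (D 0%N) (D K) S1 S2 X (law_mass nu _) (law_mass mu _) (law_mass mu _).
move=> D0 DK S1 S2 X mI aI a0 IK mIK S12.
move=> /andP[a1 a2] /andP[b1 b2] /andP[c1 c2] /andP[d1 d2].
by apply/andP; split; lra.
Qed.
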